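(* Let $\mu$ be a probability measure on $\mathbb{R}^d$ with support $D$, and let $\{V_n\}_{n=0}^\infty\subset L^2_\mu(D)$ be a hierarchical sequence of finite-dimensional subspaces with $N_n=\dim V_n$, $q^*<\infty$ and $1\in V_0$. For each $n$ let $\mathcal{A}_n=\{X_m\}_{m=1}^{M_n}$ with $X_m$ i.i.d. with distribution $\mu_{V_n}$, where $M_n=\lceil25N_n\log N_n\rceil$. Then with probability $1$, $\{\mathcal{A}_n\}_{n=0}^\infty$ forms an asymptotic WAM for $\{V_n\}_{n=0}^\infty$ with exponents $a=1+\tau$ and $b=\frac{q^*+1}{2}+\tau$, for any $\tau>0$.
   Context: Functions are complex-valued and defined pointwise on $D=\operatorname{supp}\mu$. Hierarchical means $V_n\subset V_{n+1}$ and $\dim V_n<\dim V_{n+1}$, with $N_n\ge1$. For an $N$-dimensional $V\subset L^2_\mu(D)$ with orthonormal basis $v_1,\dots,v_N$, $K(x,x)=\sum_{i=1}^N|v_i(x)|^2$ and $K_\mu(V)=\sup_{x\in D}K(x,x)$ (independent of the basis); $K_\mu(V_n)<\infty$ is assumed for all $n$. The $V$-induced measure is the probability measure $d\mu_V(x)=\frac1NK(x,x)\,d\mu(x)$. $q^*=\limsup_{n\to\infty}\frac{\log K_\mu(V_n)}{\log N_n}$. A sequence of finite sets $\mathcal{A}_n\subset D$ is an asymptotic weakly admissible mesh (asymptotic WAM) for $\{V_n\}$ with exponents $(a,b)$ if there are $N\in\mathbb{N}$ and finite constants $k_a,k_b$ such that for all $n\ge N$: $\sup_{x\in D}|v(x)|\le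 k_bN_n^b\max_{x\in\mathcal{A}_n}|v(x)|$ for all $v\in V_n$, and $|\mathcal{A}_n|\le k_aN_n^a$. (Here $N$, $k_a$, $k_b$ may depend on $\tau$ and on the realization of the samples.) *)

(* Defs.v *)
From HB Require Import structures.
From mathcomp Require Import all_boot all_order all_algebra finmap.
From mathcomp Require Import all_classical all_reals all_analysis.
From mathcomp Require Import complex.

Set Implicit Arguments.
Unset Strict Implicit.
Unset Printing Implicit Defensive.

Import Order.TTheory GRing.Theory Num.Theory.
Import numFieldTopology.Exports ComplexField.Normc.

Local Open Scope classical_set_scope.
Local Open Scope ring_scope.
Local Open Scope complex_scope.

(* R^d with its Borel sigma-algebra. *)
Notation borel_space R d := (g_sigma_algebraType (@open 'rV[R]_d)).

Definition mutually_independent d d' (Omega : measurableType d)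
    (T : measurableType d') (R : realType) (P : probability Omega R)
    (I : finType) (X : I -> Omega -> T) : Prop :=
  forall (J : {set I}) (B : I -> set T), (forall i, measurable (B i)) ->
    P (\bigcap_(i in [set` J]) X i @^-1` B i) =
    (\prod_(i in J) P (X i @^-1` B i))%E.

Section induced_sampling.
Context (R : realType) (d : nat).
Local Notation E := (borel_space R d).
Implicit Types (mu : probability E R) (V : set (E -> R[i])).

Definition msupport mu : set E :=
  [set x | forall U : set 'rV[R]_d, open U -> U x -> (0 < mu U)%E].

(* A function on D = msupport mu is represented by its extension by zero to
   R^d.  As D is closed, this is a bijection which preserves Borel
   measurability, and two such extensions are equal exactly when the functions
   agree at every point of D (not merely mu-almost everywhere). *)
Definition L2_support mu : set (E -> R[i]) :=
  [set f : E -> R[i] | [/\ forall x, ~ msupport mu x -> f x = 0,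
    measurable_fun setT (fun x => complex.Re (f x) : R),
    measurable_fun setT (fun x => complex.Im (f x) : R) &
    (\int[mu]_(x in msupport mu) (normc (f x) ^+ 2)%:E < +oo)%E]].

Definition L2_inner mu (f g : E -> R[i]) : R[i] :=
  (\int[mu]_(x in msupport mu) complex.Re (f x * (g x)^*)) +i*
  (\int[mu]_(x in msupport mu) complex.Im (f x * (g x)^*)).

Definition L2_subspace mu V : Prop :=
  [/\ V `<=` L2_support mu,
    V (fun=> 0) &
    forall c f g, V f -> V g -> V (fun x => c * f x + g x)].

(* The equations hold at every point.  In particular V has dimension N, also
   as a subspace of the quotient of L2_support mu by almost everywhere
   equality. *)
Definition orthonormal_basis mu V (N : nat) (v : 'I_N -> E -> R[i]) : Prop :=
  [/\ forall i, V (v i),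
    forall i j, L2_inner mu (v i) (v j) = (i == j)%:R &
    forall f, V f ->
      exists c : 'I_N -> R[i], f = (fun x => \sum_i c i * v i x)].

Definition hierarchical mu (V : nat -> set (E -> R[i])) (N : nat -> nat)
    (v : forall n, 'I_(N n) -> E -> R[i]) : Prop :=
  [/\ forall n, L2_subspace mu (V n),
    forall n, orthonormal_basis mu (V n) (v n),
    forall n, V n `<=` V n.+1,
    forall n, (N n < N n.+1)%N &
    forall n, (1 <= N n)%N].

Definition kernel_diag (N : nat) (v : 'I_N -> E -> R[i]) (x : E) : R :=
  \sum_i normc (v i x) ^+ 2.

Definition kernel_sup mu (N : nat) (v : 'I_N -> E -> R[i]) : \bar R :=
  ereal_sup [set (kernel_diag v x)%:E | x in msupport mu].

Definition induced_measure mu (N : nat) (v : 'I_N -> E -> R[i])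
    (A : set E) : \bar R :=
  (\int[mu]_(x in A) (N%:R^-1 * kernel_diag v x)%:E)%E.

(* If N n = 1 the quotient is 0 by the convention x / 0 = 0; for strictly
   increasing N this concerns at most one n and does not affect the limsup. *)
Definition qstar mu (N : nat -> nat) (v : forall n, 'I_(N n) -> E -> R[i]) :
    \bar R :=
  limn_esup (fun n => (ln (fine (kernel_sup mu (v n))) / ln (N n)%:R)%:E).

(* The maximum over an empty mesh is 0, so that an empty mesh only controls
   the zero function. *)
Definition asymptotic_WAM mu (V : nat -> set (E -> R[i])) (N : nat -> nat)
    (A : nat -> {fset E}) (a b : R) : Prop :=
  (forall n, [set` A n] `<=` msupport mu) /\
  exists (n0 : nat) (ka kb : R), forall n, (n0 <= n)%N ->
    (forall v, V n v ->
      (ereal_sup [set (normc (v x))%:E | x in msupport mu] <=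
       (kb * (N n)%:R `^ b *
        \big[Order.max/0]_(x <- A n) normc (v x))%:E)%E) /\
    (#|` A n|)%:R <= ka * (N n)%:R `^ a.

End induced_sampling.

Definition sample_size (R : realType) (N : nat) : nat :=
  `|Num.ceil (25 * N%:R * ln N%:R : R)|%N.

(* Main.v *)
Require Import Defs.
From HB Require Import structures.
From mathcomp Require Import all_boot all_order all_algebra finmap.
From mathcomp Require Import all_classical all_reals all_analysis.
From mathcomp Require Import complex.
From mathcomp Require Import measurable_realfun.
From mathcomp Require Import ring lra.

(* With c(x) = N / K(x) and k(x) the vector of values of the orthonormal basis,
   the matrices c(X_m) k(X_m) k(X_m)^* are i.i.d. with mean the identity and
   norm at most N.  Let S be 1/2 plus their sum over the sample and let
   phi = tr S^-2.  By the Sherman-Morrison formula every new sample decreases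
   phi, on average, by at least (phi - 1/N) / (2N), so that E phi^2 = O(N^-2)
   after M = 25 N log N steps.  This replaces a matrix Chernoff bound: outside
   of an event of probability O(N^-2) one has phi <= 1, hence S >= 1, that is,
   the sum over the sample of c(X_m) |f(X_m)|^2 is at least |f|^2 / 2 for every
   f in V.  A scalar exponential moment bound for the i.i.d. variables
   1 / K(X_m), which lie in [0,1] since 1 is in V and have mean at most 1/N,
   shows that the sum of the c(X_m) is at most 4M, again outside of an event of
   probability O(N^-2).  Together, |f(x)|^2 <= 8 M K(x) max_m |f(X_m)|^2.  As
   N_n > n, the exceptional probabilities are summable, and Borel-Cantelli
   concludes. *)

Set Implicit Arguments.
Unset Strict Implicit.
Unset Printing Implicit Defensive.

Import Order.TTheory GRing.Theory Num.Theory.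
Import numFieldTopology.Exports ComplexField.Normc.

Local Open Scope classical_set_scope.
Local Open Scope ring_scope.
Local Open Scope complex_scope.

(** * Hermitian matrices over [R[i]] and the Frobenius norm of a rank-one update *)

Section rank_one_update.
Context {R : rcfType}.
Local Notation C := R[i].

Definition adjmx m n (A : 'M[C]_(m, n)) : 'M[C]_(n, m) := (map_mx conjc A)^T.

Lemma adjmxK m n (A : 'M[C]_(m, n)) : adjmx (adjmx A) = A.
Proof. by apply/matrixP => i j; rewrite !mxE conjcK. Qed.

Lemma adjmxM m n p (A : 'M[C]_(m, n)) (B : 'M[C]_(n, p)) :
  adjmx (A *m B) = adjmx B *m adjmx A.
Proof. by rewrite /adjmx map_mxM trmx_mul. Qed.

Lemma adjmxD m n (A B : 'M[C]_(m, n)) : adjmx (A + B) = adjmx A + adjmx B.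
Proof. by rewrite /adjmx map_mxD linearD. Qed.

Lemma adjmxN m n (A : 'M[C]_(m, n)) : adjmx (- A) = - adjmx A.
Proof. by rewrite /adjmx map_mxN linearN. Qed.

Lemma adjmxZ m n (a : R) (A : 'M[C]_(m, n)) :
  adjmx (a%:C *: A) = a%:C *: adjmx A.
Proof. by rewrite /adjmx map_mxZ linearZ /= oppr0. Qed.

(** The squared modulus as a polynomial in the two parts: identities fall to [ring], and
    measurability involves no square root. *)
Definition nsq (z : C) : R := complex.Re z ^+ 2 + complex.Im z ^+ 2.

Lemma normc_sq z : normc z ^+ 2 = nsq z.
Proof. by case: z => a b; rewrite /= sqr_sqrtr // addr_ge0 ?sqr_ge0. Qed.

Lemma nsq_ge0 z : 0 <= nsq z.
Proof. by rewrite -normc_sq sqr_ge0. Qed.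

Lemma nsqM y z : nsq (y * z) = nsq y * nsq z.
Proof. by rewrite -!normc_sq normcM exprMn. Qed.

Lemma nsqJ z : nsq z^* = nsq z.
Proof. by case: z => a b; rewrite /nsq /= sqrrN. Qed.

Lemma ReD (y z : C) : complex.Re (y + z) = complex.Re y + complex.Re z.
Proof. by case: y z => [? ?] [? ?]. Qed.

Lemma ImD (y z : C) : complex.Im (y + z) = complex.Im y + complex.Im z.
Proof. by case: y z => [? ?] [? ?]. Qed.

Lemma Re_sum I (r : seq I) (P : pred I) (F : I -> C) :
  complex.Re (\sum_(i <- r | P i) F i) = \sum_(i <- r | P i) complex.Re (F i).
Proof. exact: (big_morph _ ReD). Qed.

(** Taking the real part gives a symmetric bilinear form over [R]; nothing is lost on quadratic
    forms of Hermitian matrices, whose values are real. *)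
Definition dot n (x y : 'cV[C]_n) : R := complex.Re ((adjmx x *m y) 0 0).

Lemma dotE n (x y : 'cV[C]_n) : dot x y =
  \sum_i (complex.Re (x i 0) * complex.Re (y i 0) +
          complex.Im (x i 0) * complex.Im (y i 0)).
Proof.
rewrite /dot mxE Re_sum; apply: eq_bigr => i _; rewrite !mxE.
by case: (x i 0) (y i 0) => [a b] [e f] /=; ring.
Qed.

Lemma dotC n (x y : 'cV[C]_n) : dot x y = dot y x.
Proof.
by rewrite !dotE; apply: eq_bigr => i _; congr (_ + _); rewrite mulrC.
Qed.

Lemma dotxx n (x : 'cV[C]_n) : dot x x = \sum_i nsq (x i 0).
Proof. by rewrite dotE; apply: eq_bigr => i _; rewrite /nsq !expr2. Qed.

Lemma dotxx_ge0 n (x : 'cV[C]_n) : 0 <= dot x x.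
Proof. by rewrite dotxx; apply: sumr_ge0 => i _; exact: nsq_ge0. Qed.

Lemma dotDr n (x y z : 'cV[C]_n) : dot x (y + z) = dot x y + dot x z.
Proof. by rewrite /dot mulmxDr mxE ReD. Qed.

Lemma dotNr n (x y : 'cV[C]_n) : dot x (- y) = - dot x y.
Proof. by rewrite /dot mulmxN mxE; case: (_ 0 0). Qed.

Lemma dotZr n (a : R) (x y : 'cV[C]_n) : dot x (a%:C *: y) = a * dot x y.
Proof.
rewrite /dot -scalemxAr mxE; case: ((adjmx x *m y) 0 0) => e f /=.
by rewrite mul0r subr0.
Qed.

Lemma dotDl n (x y z : 'cV[C]_n) : dot (x + y) z = dot x z + dot y z.
Proof. by rewrite dotC dotDr !(dotC z). Qed.

Lemma dotNl n (x y : 'cV[C]_n) : dot (- x) y = - dot x y.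
Proof. by rewrite dotC dotNr dotC. Qed.

Lemma dotZl n (a : R) (x y : 'cV[C]_n) : dot (a%:C *: x) y = a * dot x y.
Proof. by rewrite dotC dotZr dotC. Qed.

Lemma dot_adj m n (A : 'M[C]_(m, n)) x y :
  dot x (A *m y) = dot (adjmx A *m x) y.
Proof. by rewrite /dot adjmxM adjmxK mulmxA. Qed.

(** The squared Frobenius norm. For Hermitian [A] it is tr A^2, so at the inverse of S it is the
    potential phi. *)
Definition frob n (A : 'M[C]_n) : R := \sum_i \sum_j nsq (A i j).

Lemma frob_ge0 n (A : 'M[C]_n) : 0 <= frob A.
Proof. by apply: sumr_ge0 => i _; apply: sumr_ge0 => j _; exact: nsq_ge0. Qed.

(** Evaluate at the minimiser [b / c]. For [c = 0] the expression is affine in [t], and if [b] were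
    nonzero it would take the value -1. *)
Lemma discriminant_le (a b c : R) : 0 <= c ->
  (forall t, 0 <= a - 2 * t * b + t ^+ 2 * c) -> b ^+ 2 <= a * c.
Proof.
rewrite le_eqVlt => /predU1P[<- h|c0 h].
  have [->|b0] := eqVneq b 0; first by rewrite expr0n /= mulr0.
  have := h ((a + 1) / (2 * b)); rewrite mulr0 addr0.
  have -> : 2 * ((a + 1) / (2 * b)) * b = a + 1 by field.
    by lra.
have := h (b / c); rewrite -(ler_pM2r c0) mul0r.
suff -> : (a - 2 * (b / c) * b + (b / c) ^+ 2 * c) * c = a * c - b ^+ 2.
  by rewrite subr_ge0.
by field; rewrite gt_eqF.
Qed.

Lemma nsq_sub (y z : C) (t : R) :
  nsq (y - t%:C * z) = nsq y - 2 * t * complex.Re (y * z^*) + t ^+ 2 * nsq z.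
Proof. by case: y z => [a b] [e f]; rewrite /nsq /=; ring. Qed.

(** Complex Cauchy-Schwarz from the real discriminant: multiplying the conjugates of the [b i] by
    the sum [u] itself makes the cross term the real number [nsq u], one factor of which cancels at
    the end. *)
Lemma nsq_sum_le (I : finType) (a b : I -> C) :
  nsq (\sum_i a i * b i) <= (\sum_i nsq (a i)) * (\sum_i nsq (b i)).
Proof.
set u := \sum_i _; set p := \sum_i _; set q := \sum_i _.
have p0 : 0 <= p by apply: sumr_ge0 => i _; exact: nsq_ge0.
have q0 : 0 <= q by apply: sumr_ge0 => i _; exact: nsq_ge0.
have : nsq u ^+ 2 <= p * (nsq u * q).
  apply: discriminant_le => [|t]; first by rewrite mulr_ge0 // nsq_ge0.
  have : 0 <= \sum_i nsq (a i - t%:C * (u * (b i)^*)).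
    by apply: sumr_ge0 => i _; exact: nsq_ge0.
  under eq_bigr do rewrite nsq_sub nsqM nsqJ.
  rewrite 2!big_split /= sumrN -!mulr_sumr -Re_sum.
  suff -> : \sum_i a i * (u * (b i)^*)^* = (nsq u)%:C by [].
  under eq_bigr do rewrite (rmorphM conjc) /= conjcK mulrCA.
  rewrite -mulr_sumr -/u; case: (u) => e f; rewrite /nsq /=.
  by congr (_ +i* _); ring.
have := nsq_ge0 u; rewrite le_eqVlt => /predU1P[<- _|u0].
  by rewrite mulr_ge0.
by rewrite expr2 mulrCA ler_pM2l.
Qed.

Lemma dot_mulmx_le n (A : 'M[C]_n) (x : 'cV[C]_n) :
  dot (A *m x) (A *m x) <= frob A * dot x x.
Proof.
rewrite !dotxx /frob mulr_suml; apply: ler_sum => i _.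
by rewrite mxE; exact: nsq_sum_le.
Qed.

Lemma frob_sub_outer n (A : 'M[C]_n) (t : R) (z : 'cV[C]_n) :
  frob (A - t%:C *: (z *m adjmx z)) =
  frob A - 2 * t * dot z (A *m z) + t ^+ 2 * dot z z ^+ 2.
Proof.
have -> : frob (A - t%:C *: (z *m adjmx z)) = \sum_i \sum_j
   (nsq (A i j) - 2 * t * complex.Re ((z i 0)^* * (A i j * z j 0)) +
    t ^+ 2 * (nsq (z i 0) * nsq (z j 0))).
  apply: eq_bigr => i _; apply: eq_bigr => j _.
  rewrite !mxE big_ord1 !mxE nsq_sub nsqM nsqJ (rmorphM conjc) /= conjcK.
  by rewrite mulrCA.
under eq_bigr do rewrite 2!big_split /= sumrN -!mulr_sumr.
rewrite 2!big_split /= sumrN -!mulr_sumr; congr (_ - _ * _ + _ * _).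
  rewrite /dot mxE Re_sum; apply: eq_bigr => i _.
  rewrite -Re_sum -mulr_sumr !mxE //.
by rewrite -mulr_suml expr2 !dotxx.
Qed.

(** Only [b = N * a2 > 1] has content. After multiplication by [N * a1] and use of
    [a2 ^+ 2 <= a1 * a3], what remains is (b - 1)(a1 + a1^2) <= 2 b^2, which follows from a1 <= (1 +
    a1^2) / 2 and a1^2 <= b. *)
Lemma contraction_rate (N a1 a2 a3 : R) : 0 < N ->
  0 <= a1 -> 0 <= a2 -> 0 <= a3 -> a2 ^+ 2 <= a1 * a3 -> a1 ^+ 2 <= N * a2 ->
  (a2 - N^-1) * (1 + a1) <= a3 * (2 * N).
Proof.
move=> N0 a1_ge0 a2_ge0 a3_ge0 a22 a12.
have [a2N|a2N] := leP (N * a2) 1.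
  apply: (@le_trans _ _ 0); last by rewrite !mulr_ge0 // ltW.
  rewrite mulr_le0_ge0 ?addr_ge0 // subr_le0 -(ler_pM2l N0) divff //.
  by rewrite gt_eqF.
rewrite -(ler_pM2l N0).
have -> : N * ((a2 - N^-1) * (1 + a1)) = (N * a2 - 1) * (1 + a1).
  by field; rewrite gt_eqF.
move: a1_ge0; rewrite le_eqVlt => /predU1P[a10|a1_gt0].
  by move: a22 a12 a2N; rewrite -a10; nra.
rewrite -(ler_pM2l a1_gt0).
apply: (@le_trans _ _ (2 * (N * a2) ^+ 2)); last first.
  by rewrite exprMn; nra.
set b := N * a2 in a12 a2N *.
have : a1 * (1 + a1) <= (1 + b) / 2 + b by nra.
nra.
Qed.

(* Here [d_j] stands for [k^* A^j k], and [f] for [tr A^2]. *)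
Lemma rank_one_decrease (N c f d0 d1 d2 d3 : R) : 0 < N -> 0 <= c ->
  c * d0 <= N -> 0 <= d1 -> 0 <= d2 -> 0 <= d3 ->
  d2 ^+ 2 <= d1 * d3 -> d1 ^+ 2 <= d0 * d2 ->
  let t := c / (1 + c * d1) in
  f - 2 * t * d3 + t ^+ 2 * d2 ^+ 2 <= f /\
  f - 2 * t * d3 + t ^+ 2 * d2 ^+ 2 <= f - (c * d2 - N^-1) / (2 * N).
Proof.
move=> N0 c0 cN d1_ge0 d2_ge0 d3_ge0 d22 d12 /=.
have [e1_ge0 e2_ge0 e3_ge0] : [/\ 0 <= c * d1, 0 <= c * d2 & 0 <= c * d3].
  by rewrite !mulr_ge0.
have e_gt0 : 0 < 1 + c * d1 by rewrite ltr_pwDl.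
have e22 : (c * d2) ^+ 2 <= (c * d1) * (c * d3).
  have -> : c * d1 * (c * d3) = c ^+ 2 * (d1 * d3) by ring.
  by rewrite exprMn ler_wpM2l // sqr_ge0.
have e12 : (c * d1) ^+ 2 <= N * (c * d2).
  apply: le_trans (ler_wpM2r e2_ge0 cN).
  have -> : c * d0 * (c * d2) = c ^+ 2 * (d0 * d2) by ring.
  by rewrite exprMn ler_wpM2l // sqr_ge0.
(* As [t * d1 <= 1], the second-order term t^2 d2^2 <= t^2 d1 d3 takes back at most half of the
   first-order gain 2 t d3. *)
have main : f - 2 * (c / (1 + c * d1)) * d3 + (c / (1 + c * d1)) ^+ 2 * d2 ^+ 2
            <= f - (c * d3) / (1 + c * d1).
  have -> : f - 2 * (c / (1 + c * d1)) * d3 +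
      (c / (1 + c * d1)) ^+ 2 * d2 ^+ 2 = f - (c * d3) / (1 + c * d1) -
      ((c * d3) * (1 + c * d1) - (c * d2) ^+ 2) / (1 + c * d1) ^+ 2.
    by field; rewrite gt_eqF.
  rewrite lerBlDr lerDl divr_ge0 ?sqr_ge0 // subr_ge0.
  by apply: le_trans e22 _; rewrite mulrDr mulr1 mulrC lerDr.
split; apply: le_trans main _.
  by rewrite lerBlDr lerDl divr_ge0 // ltW.
rewrite lerD2l lerN2 ler_pdivrMr ?mulr_gt0 // mulrAC ler_pdivlMr //.
exact: contraction_rate.
Qed.

Lemma dot_form_cauchy n (B : 'M[C]_n) : adjmx B = B ->
  (forall x, 0 <= dot x (B *m x)) ->
  forall x y, dot x (B *m y) ^+ 2 <= dot x (B *m x) * dot y (B *m y).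
Proof.
move=> adjB B_ge0 x y; apply: discriminant_le => // t.
have := B_ge0 (x - t%:C *: y).
rewrite mulmxDr mulmxN -scalemxAr dotDr dotNr dotZr !dotDl !dotNl !dotZl.
have -> : dot y (B *m x) = dot x (B *m y) by rewrite dot_adj adjB dotC.
move: (dot x _) (dot x _) (dot y _) => p q r; lra.
Qed.

Lemma adjmx1 n : adjmx (1%:M : 'M[C]_n) = 1%:M.
Proof. by rewrite /adjmx map_mx1 trmx1. Qed.

Lemma dot1_ge0 n (x : 'cV[C]_n) : 0 <= dot x (1%:M *m x).
Proof. by rewrite mul1mx dotxx_ge0. Qed.

(** Both matrices are kept as data, so that the inverse is updated by a formula instead of being
    recomputed. The last clause bounds the spectrum of [S] from below and makes [A] positive
    semidefinite once [0 <= e]. *)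
Definition inverse_pair n (e : R) (S A : 'M[C]_n) : Prop :=
  [/\ adjmx S = S, adjmx A = A, S *m A = 1%:M &
      forall x, e * dot x x <= dot x (S *m x)].

(* The Sherman-Morrison formula for the inverse of [S + c k k^*], where A is
   the inverse of S. *)
Definition rank_one_inv n (c : R) (k : 'cV[C]_n) (A : 'M[C]_n) : 'M[C]_n :=
  A - (c / (1 + c * dot k (A *m k)))%:C *: ((A *m k) *m adjmx (A *m k)).

Section pair.
Variables (n : nat) (e : R) (S A : 'M[C]_n).
Hypotheses (e0 : 0 <= e) (SA : inverse_pair e S A).

Lemma inverse_pair_ge0 x : 0 <= dot x (A *m x).
Proof.
have [adjS adjA SA1 Sge] := SA.
have -> : dot x (A *m x) = dot (A *m x) (S *m (A *m x)).
  by rewrite mulmxA SA1 mul1mx dotC.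
by apply: le_trans (Sge _); rewrite mulr_ge0 // dotxx_ge0.
Qed.

(** The 1 x 1 matrix is its own adjoint. This lets the Sherman-Morrison denominator be written with
    the real number [dot k (A *m k)]. *)
Lemma hermitian_form_real (k : 'cV[C]_n) :
  adjmx k *m (A *m k) = (dot k (A *m k))%:C%:M.
Proof.
have [_ adjA _ _] := SA.
rewrite /dot; set t := (adjmx k *m (A *m k)).
have adjt : adjmx t = t by rewrite /t !adjmxM adjmxK adjA mulmxA.
have tt : (t 0 0)^* = t 0 0 by rewrite -[in RHS]adjt !mxE.
apply/matrixP => i j; rewrite !ord1 [RHS]mxE eqxx mulr1n.
case: (t 0 0) tt => a b -[] /eqP; rewrite eq_sym -subr_eq0 opprK => /eqP bb.
have -> : b = 0 by lra.
by [].
Qed.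

Lemma inverse_pair_update (c : R) (k : 'cV[C]_n) : 0 <= c ->
  inverse_pair e (S + c%:C *: (k *m adjmx k)) (rank_one_inv c k A).
Proof.
move=> c0; have [adjS adjA SA1 Sge] := SA; split.
- by rewrite adjmxD adjS adjmxZ adjmxM adjmxK.
- by rewrite /rank_one_inv adjmxD adjmxN adjA adjmxZ [in LHS]adjmxM adjmxK.
- rewrite /rank_one_inv mulmxDl !mulmxDr SA1 -!addrA.
  rewrite [X in _ + X](_ : _ = 0) ?addr0 //.
  have r0 := inverse_pair_ge0 k; have hr := hermitian_form_real k.
  move: r0 hr; set r := dot k _ => r0 hr.
  rewrite !mulmxN -!scalemxAr -!scalemxAl.
  have -> : S *m (A *m k *m adjmx (A *m k)) = k *m adjmx k *m A.
    by rewrite !mulmxA SA1 mul1mx adjmxM adjA mulmxA.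
  have -> : k *m adjmx k *m (A *m k *m adjmx (A *m k)) =
            r%:C *: (k *m adjmx k *m A).
    rewrite -!mulmxA (mulmxA (adjmx k)) (mulmxA (adjmx k *m A)).
    rewrite -(mulmxA (adjmx k)) hr.
    by rewrite mul_scalar_mx -scalemxAr adjmxM adjA.
  rewrite !scalerA -!scaleNr -!scalerDl.
  (* Every correction term is a multiple of the one matrix k k^* A; with t = c / (1 + c r) the
     coefficients add up to c - t - c t r = 0. *)
  set K := k *m _ *m A; set u := (X in X *: K).
  have -> : u = 0; last by rewrite scale0r.
  rewrite /u.
  rewrite -!rmorphM -!rmorphN -!rmorphD.
  have r1 : 1 + c * r != 0 by rewrite gt_eqF // ltr_pwDl // mulr_ge0.
  by rewrite -[RHS]/(0%:C); congr (_%:C); field.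
- move=> x; rewrite mulmxDl dotDr -scalemxAl dotZr.
  rewrite -mulmxA (dot_adj k) -[leLHS]addr0 lerD // mulr_ge0 //.
  exact: dotxx_ge0.
Qed.


(** Cauchy-Schwarz for the forms of [A] and of the identity supplies the two inequalities between
    the numbers k^* A^j k that [rank_one_decrease] asks for. The first bound holds along every path;
    the second one yields the decrease in mean. *)
Lemma frob_rank_one_inv_le (N : R) (c : R) (k : 'cV[C]_n) :
  0 <= c -> 0 < N -> c * dot k k <= N ->
  frob (rank_one_inv c k A) <= frob A /\
  frob (rank_one_inv c k A) <=
    frob A - (c * dot (A *m k) (A *m k) - N^-1) / (2 * N).
Proof.
move=> c0 N0 ckN; have [adjS adjA SA1 Sge] := SA.
rewrite /rank_one_inv frob_sub_outer.
apply: (@rank_one_decrease N c _ (dot k k)) => //.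
- exact: inverse_pair_ge0.
- exact: dotxx_ge0.
- exact: inverse_pair_ge0.
- have := dot_form_cauchy adjA inverse_pair_ge0 (A *m k) k.
  by rewrite mulrC.
- have := dot_form_cauchy (@adjmx1 n) (@dot1_ge0 n) k (A *m k).
  by rewrite !mul1mx.
Qed.

(** The Frobenius norm dominates the operator norm, so A <= 1. Inversion reverses the order:
    Cauchy-Schwarz for the form of [A] at S x and x gives |x|^4 <= (x^* S x) (x^* A x) <= (x^* S x)
    |x|^2. *)
Lemma inverse_pair_lower_bound x : frob A <= 1 -> dot x x <= dot x (S *m x).
Proof.
move=> fA; have [adjS adjA SA1 Sge] := SA.
have AS1 : A *m S = 1%:M by exact: mulmx1C.
have A_le y : dot y (A *m y) <= dot y y.
  have := dotxx_ge0 (y - A *m y).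
  rewrite dotDr dotNr !dotDl !dotNl (dotC (A *m y) y).
  have := le_trans (dot_mulmx_le A y) (ler_wpM2r (dotxx_ge0 y) fA).
  move: (dot y y) (dot y _) (dot (A *m y) _) => p q r; lra.
have xE : x = A *m (S *m x) by rewrite mulmxA AS1 mul1mx.
have b0 : dot x (S *m x) = dot (S *m x) (A *m (S *m x)) by rewrite -xE dotC.
have : dot x x ^+ 2 <= dot x (S *m x) * dot x x.
  apply: (@le_trans _ _ (dot x (S *m x) * dot x (A *m x))); last first.
    by apply: ler_wpM2l (A_le x); rewrite b0; exact: inverse_pair_ge0.
  have := dot_form_cauchy adjA inverse_pair_ge0 (S *m x) x.
  by rewrite (dot_adj A (S *m x)) adjA -xE (dotC (S *m x)).
have : 0 <= dot x x by exact: dotxx_ge0.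
rewrite le_eqVlt => /predU1P[<- _|a_gt0].
  by rewrite b0; exact: inverse_pair_ge0.
by rewrite expr2 ler_pM2r.
Qed.

End pair.
End rank_one_update.

(** * Independence of a sample from its past, and change of density *)

Section past.
Context d d' (Omega : measurableType d) (T : measurableType d').
Variable Y : nat -> {mfun Omega >-> T}.

(** Cylinders are closed under intersection, as the uniqueness theorem for measures requires. The
    sigma-algebra they generate is put on a second type, [past m], so that measurability with
    respect to the first [m] samples is ordinary measurability there. *)
Definition past_events (m : nat) : set (set Omega) :=
  [set A | exists2 B : nat -> set T, (forall i, measurable (B i)) &
    A = \bigcap_(i < m) Y i @^-1` B i].

Local Notation past m := (g_sigma_algebraType (past_events m)).

Lemma past_events_measurable m : past_events m `<=` measurable.
Proof.
move=> _ [B mB ->]; apply: bigcap_measurableType => i _.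
by rewrite -[X in measurable X]setTI; exact: measurable_funP.
Qed.

Lemma setI_closed_past_events m : setI_closed (past_events m).
Proof.
move=> _ _ [B mB ->] [C mC ->]; exists (fun i => B i `&` C i).
  by move=> i; exact: measurableI.
by rewrite -bigcapI; apply: eq_bigcapr => i _; rewrite preimage_setI.
Qed.

Lemma past_measurable m (A : set Omega) :
  measurable (A : set (past m)) -> measurable A.
Proof.
apply: smallest_sub; first exact: sigma_algebra_measurable.
exact: past_events_measurable.
Qed.

Lemma measurable_past m i :
  (i < m)%N -> measurable_fun setT (Y i : past m -> T).
Proof.
move=> im _ B mB; rewrite setTI; apply: sub_sigma_algebra.
exists (fun j => if j == i then B else setT).
  by move=> j; case: ifP.
apply/seteqP; split=> [w Bw j _ /=|w /(_ i im) /=]; last by rewrite eqxx.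
by case: eqP => // ->.
Qed.

End past.
Section independence.
Context d d' (Omega : measurableType d) (T : measurableType d') (R : realType).
Variables (P : probability Omega R) (Y : nat -> {mfun Omega >-> T}) (m : nat).
Hypothesis indep : forall n B, (n <= m.+1)%N -> (forall i, measurable (B i)) ->
  P (\bigcap_(i < n) Y i @^-1` B i) = (\prod_(i < n) P (Y i @^-1` B i))%E.
Local Notation past := (g_sigma_algebraType (past_events Y m)).

(** As functions of [A], both sides are finite measures that agree on the cylinders, hence on the
    sigma-algebra of the past. *)
Lemma independent_of_past (A : set Omega) (C : set T) :
  measurable (A : set past) -> measurable C ->
  P (A `&` Y m @^-1` C) = (P A * P (Y m @^-1` C))%E.
Proof.
move=> mA mC.
have mYC : measurable (Y m @^-1` C).
  by rewrite -[X in measurable X]setTI; exact: measurable_funP.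
have fP : P (Y m @^-1` C) \is a fin_num by exact: fin_num_measure.
pose r := NngNum (fine_ge0 (measure_ge0 P (Y m @^-1` C))).
have rE : r%:num%:E = P (Y m @^-1` C) by rewrite /= fineK.
suff : mrestr P mYC A = mscale r P A.
  by rewrite /mscale /mrestr rE muleC.
apply: (g_sigma_algebra_measure_unique (past_events Y m)
  (@past_events_measurable _ _ _ _ _ m) (fun=> setT)) => //.
- move=> _; exists (fun=> setT) => //.
  by apply/seteqP; split=> // x _ i _.
- by rewrite bigcup_const //; exists 0%N.
- exact: setI_closed_past_events.
- move=> _ [B mB ->]; rewrite [LHS]/= [RHS]/= /mscale /mrestr rE.
  (* A cylinder of length [m] cut by the event [Y m] in [C] is a cylinder of length [m.+1], so
     [indep] applies to it. *)
  pose B' i := if i == m then C else B i.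
  have mB' i : measurable (B' i) by rewrite /B'; case: ifP.
  have /(_ _ mB') := @indep m.+1 _ (leqnn _).
  rewrite big_ord_recr /= /B' eqxx.
  under eq_bigr => i _ do rewrite (ltn_eqF (ltn_ord i)).
  rewrite -indep // muleC => <-; congr (P _).
  apply/seteqP; split=> [w [wB wC] i /=|w wB].
    by rewrite ltnS leq_eqVlt => /predU1P[->|im];
       rewrite ?eqxx ?(ltn_eqF im) //;
       exact: wB.
  split=> [i /= im|]; last by have := wB m (leqnn _); rewrite /= eqxx.
  by have := wB i (ltnW im); rewrite /= (ltn_eqF im).
- by move=> _; rewrite /= /mrestr setTI ltey_eq fP.
Qed.

Variable nu : probability T R.
Hypothesis law : forall C, measurable C -> P (Y m @^-1` C) = nu C.

(** By independence the joint law of the past and [Y m] is a product measure, and Tonelli integrates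
    the new sample with the past frozen. This plays the part of conditional expectation. *)
Lemma expectation_past (f : past * T -> \bar R) :
  measurable_fun [set: past * T] f -> (forall z, 0 <= f z)%E ->
  (\int[P]_w f (w, Y m w) = \int[P]_w \int[nu]_x f (w, x))%E.
Proof.
move=> mf f0.
have mid : measurable_fun setT (id : Omega -> past).
  by move=> _ A mA; rewrite setTI; exact: past_measurable mA.
(* The identity into the coarser space is a random variable whose law is [P] restricted to the
   past. *)
pose idY : {mfun Omega >-> past} :=
  HB.pack (id : Omega -> past) (isMeasurableFun.Build _ _ _ _ _ mid).
have mpair : measurable_fun setT (fun w => (w, Y m w) : past * T).
  by apply/measurable_fun_pairP; split; [exact: mid|exact: measurable_funPT].
pose pairY : {mfun Omega >-> (past * T)%type} :=
  HB.pack (fun w => (w, Y m w) : past * T)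
    (isMeasurableFun.Build _ _ _ _ _ mpair).
pose Q := distribution P idY.
have pairE : forall Z, measurable Z -> (Q \x nu)%E Z = distribution P pairY Z.
  apply: product_measure_unique => A C mA mC.
  rewrite /distribution /pushforward /= -law //.
  by rewrite -(independent_of_past mA mC).
transitivity (\int[distribution P pairY]_z f z)%E.
  by rewrite ge0_integral_pushforward.
transitivity (\int[Q \x nu]_z f z)%E.
  by apply: eq_measure_integral => A mA _; exact: esym (pairE A mA).
rewrite fubini_tonelli1 // ge0_integral_pushforward //.
  exact: measurable_fun_fubini_tonelli_F.
by move=> w _; apply: integral_ge0.
Qed.

End independence.

(** The function [g] agrees [mu]-almost everywhere with the Radon-Nikodym derivative of [nu], having
    the same integral over every measurable set. *)
Lemma ge0_integral_density d (T : measurableType d) (R : realType)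
    (mu nu : probability T R) (g : T -> R) (f : T -> \bar R) :
  measurable_fun setT g ->
  (forall A, measurable A -> nu A = \int[mu]_(x in A) (g x)%:E)%E ->
  measurable_fun setT f -> (forall x, 0 <= f x)%E ->
  (\int[nu]_x f x = \int[mu]_x (f x * (g x)%:E))%E.
Proof.
move=> mg nuE mf f0.
have numu : nu `<< mu.
  apply/null_content_dominatesP => A mA A0.
  rewrite nuE // null_set_integral //.
  exact/measurable_EFinP/measurable_funTS.
rewrite -(Radon_Nikodym_SigmaFinite.change_of_variables numu f0 measurableT mf).
have mEg : measurable_fun setT (fun x => (g x)%:E) by exact/measurable_EFinP.
have int_rn := Radon_Nikodym_SigmaFinite.f_integrable numu.
apply: ae_eq_integral => //; first last.
- apply: ae_eqe_mul2l; apply: integral_ae_eq => // A _ mA.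
  rewrite -(nuE A mA).
  exact: esym (Radon_Nikodym_SigmaFinite.f_integral numu mA).
- exact: emeasurable_funM.
- by apply: emeasurable_funM => //; exact: measurable_int int_rn.
Qed.

(** * Measurability of complex-valued functions *)

Section cmeasurable.
Context {R : realType}.

Definition cmeasurable d (T : measurableType d) (f : T -> R[i]) : Prop :=
  measurable_fun setT (fun x => complex.Re (f x) : R) /\
  measurable_fun setT (fun x => complex.Im (f x) : R).

Context d (T : measurableType d).
Implicit Types f g : T -> R[i].

Lemma cmeasurable_cst z : cmeasurable (fun _ : T => z).
Proof. by split. Qed.

Lemma cmeasurableD f g : cmeasurable f -> cmeasurable g ->
  cmeasurable (fun x => f x + g x).
Proof.
move=> [mrf mif] [mrg mig]; split.
  by under eq_fun do rewrite ReD; exact: measurable_funD.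
by under eq_fun do rewrite ImD; exact: measurable_funD.
Qed.

Lemma cmeasurableN f : cmeasurable f -> cmeasurable (fun x => - f x).
Proof.
move=> [mrf mif]; split.
  rewrite (_ : (fun x => _) = (fun x => - complex.Re (f x))).
    exact: measurable_funN.
  by apply/funext => x; case: (f x).
rewrite (_ : (fun x => _) = (fun x => - complex.Im (f x))).
  exact: measurable_funN.
by apply/funext => x; case: (f x).
Qed.

Lemma cmeasurableM f g : cmeasurable f -> cmeasurable g ->
  cmeasurable (fun x => f x * g x).
Proof.
move=> [mrf mif] [mrg mig]; split.
  rewrite (_ : (fun x => _) = (fun x => complex.Re (f x) * complex.Re (g x) -
      complex.Im (f x) * complex.Im (g x))).
    by apply: measurable_funB; exact: measurable_funM.
  by apply/funext => x; case: (f x) (g x) => [? ?] [].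
rewrite (_ : (fun x => _) = (fun x => complex.Re (f x) * complex.Im (g x) +
    complex.Im (f x) * complex.Re (g x))).
  by apply: measurable_funD; exact: measurable_funM.
by apply/funext => x; case: (f x) (g x) => [? ?] [].
Qed.

Lemma cmeasurableJ f : cmeasurable f -> cmeasurable (fun x => (f x)^*).
Proof.
move=> [mrf mif]; split.
  rewrite (_ : (fun x => _) = (fun x => complex.Re (f x))) //.
  by apply/funext => x; case: (f x).
rewrite (_ : (fun x => _) = (fun x => - complex.Im (f x))).
  exact: measurable_funN.
by apply/funext => x; case: (f x).
Qed.

Lemma cmeasurable_sum (I : Type) (r : seq I) (F : I -> T -> R[i]) :
  (forall i, cmeasurable (F i)) -> cmeasurable (fun x => \sum_(i <- r) F i x).
Proof.
move=> mF; elim: r => [|i r IHr].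
  by under eq_fun do rewrite big_nil; exact: cmeasurable_cst.
by under eq_fun do rewrite big_cons; exact: cmeasurableD.
Qed.

Lemma cmeasurable_real (h : T -> R) :
  measurable_fun setT h -> cmeasurable (fun x => (h x)%:C).
Proof. by split => //; exact: measurable_cst. Qed.

Lemma measurable_nsq f :
  cmeasurable f -> measurable_fun setT (fun x => nsq (f x)).
Proof.
by move=> [mrf mif]; apply: measurable_funD; exact: measurable_funX.
Qed.

(** Inversion is the power with exponent -1; both take the value 0 at 0, so zeros of [h] do no
    harm. *)
Lemma measurable_inv (h : T -> R) : (forall x, 0 <= h x) ->
  measurable_fun setT h -> measurable_fun setT (fun x => (h x)^-1).
Proof.
move=> h0 mh.
have -> : (fun x => (h x)^-1) = (@powR R ^~ (-1)) \o h.
  by apply/funext => x /=; rewrite powR_inv1.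
by apply: measurableT_comp => //; exact: measurable_powR.
Qed.

Lemma measurable_real_sum (I : Type) (r : seq I) (F : I -> T -> R) :
  (forall i, measurable_fun setT (F i)) ->
  measurable_fun setT (fun x => \sum_(i <- r) F i x).
Proof.
move=> mF; elim: r => [|i r IHr].
  by under eq_fun do rewrite big_nil; exact: measurable_cst.
by under eq_fun do rewrite big_cons; exact: measurable_funD.
Qed.

End cmeasurable.

(** * Parseval's identity for an orthonormal system *)

Lemma normr_mulJ_le (R : rcfType) (y z : R[i]) :
  `|complex.Re (y * z^*)| <= nsq y + nsq z /\
  `|complex.Im (y * z^*)| <= nsq y + nsq z.
Proof.
rewrite !ler_norml /nsq; case: y z => [a b] [e f] /=.
have [] := (sqr_ge0 (a - e), sqr_ge0 (a + e)).
have [] := (sqr_ge0 (b - f), sqr_ge0 (b + f)).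
have [] := (sqr_ge0 (a - f), sqr_ge0 (a + f)).
have [] := (sqr_ge0 (b - e), sqr_ge0 (b + e)).
have [] := (sqr_ge0 a, sqr_ge0 b); have [] := (sqr_ge0 e, sqr_ge0 f).
rewrite !sqrrD !sqrrN !mulrN !mulr2n => *.
by split; apply/andP; split; lra.
Qed.

Section orthonormal.
Context {R : realType} d (T : measurableType d) (mu : probability T R).
Variables (D : set T) (n : nat) (v : 'I_n -> T -> R[i]).
Hypothesis mD : measurable D.
Hypothesis mv : forall i, cmeasurable (v i).
Hypothesis v_lty : forall i, (\int[mu]_(x in D) (nsq (v i x))%:E < +oo)%E.
Hypothesis v_ortho : forall i j,
  ((\int[mu]_(x in D) complex.Re (v i x * (v j x)^*)) +i*
   (\int[mu]_(x in D) complex.Im (v i x * (v j x)^*)) : R[i]) = (i == j)%:R.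

Lemma integrable_mulJ i j :
  mu.-integrable D (EFin \o (fun x => complex.Re (v i x * (v j x)^*))) /\
  mu.-integrable D (EFin \o (fun x => complex.Im (v i x * (v j x)^*))).
Proof.
have int_nsq k : mu.-integrable D (EFin \o (fun x => nsq (v k x))).
  apply/integrableP; split.
    exact/measurable_EFinP/measurable_funTS/measurable_nsq.
  under eq_integral do rewrite /= ger0_norm ?nsq_ge0 //.
  exact: v_lty.
have int_add : mu.-integrable D
    (EFin \o (fun x => nsq (v i x) + nsq (v j x))).
  exact: integrableD (int_nsq i) (int_nsq j).
have [mre mim] : cmeasurable (fun x => v i x * (v j x)^*).
  by apply: cmeasurableM => //; exact: cmeasurableJ.
split; apply: le_integrable int_add => //.
- exact/measurable_EFinP/measurable_funTS.
- move=> x _; rewrite /= lee_fin [leRHS]ger0_norm; last first.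
    by apply: addr_ge0; exact: nsq_ge0.
  exact: (normr_mulJ_le _ _).1.
- exact/measurable_EFinP/measurable_funTS.
- move=> x _; rewrite /= lee_fin [leRHS]ger0_norm; last first.
    by apply: addr_ge0; exact: nsq_ge0.
  exact: (normr_mulJ_le _ _).2.
Qed.

Lemma integral_nsq_sum (c : 'I_n -> R[i]) :
  (\int[mu]_(x in D) (nsq (\sum_i c i * v i x))%:E =
   (\sum_i nsq (c i))%:E)%E.
Proof.
pose re i j x := complex.Re (v i x * (v j x)^*).
pose im i j x := complex.Im (v i x * (v j x)^*).
pose a i j := complex.Re (c i * (c j)^*).
pose b i j := complex.Im (c i * (c j)^*).
have nsqE x : nsq (\sum_i c i * v i x) =
    \sum_i \sum_j (a i j * re i j x - b i j * im i j x).
  have -> z : nsq z = complex.Re (z * z^*) :> R.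
    by case: z => p q; rewrite /nsq /= mulrN opprK !expr2.
  rewrite rmorph_sum /= mulr_suml Re_sum; apply: eq_bigr => i _.
  rewrite mulr_sumr Re_sum; apply: eq_bigr => j _.
  rewrite (rmorphM conjc) /= mulrACA /a /b /re /im.
  by case: (c i * _) (v i x * _) => [? ?] [].
transitivity (\sum_i \sum_j ((a i j)%:E * \int[mu]_(x in D) (re i j x)%:E -
   (b i j)%:E * \int[mu]_(x in D) (im i j x)%:E))%E.
  under eq_integral => x _.
    rewrite nsqE -sumEFin.
    under eq_bigr do rewrite -sumEFin.
    over.
  have int_ab i j : mu.-integrable D
      (EFin \o (fun x => a i j * re i j x)) /\
    mu.-integrable D (EFin \o (fun x => b i j * im i j x)).
    have [ire iim] := integrable_mulJ i j.
    split; first exact: (integrableZl mD (a i j) ire).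
    exact: (integrableZl mD (b i j) iim).
  have int_ij i j : mu.-integrable D
      (fun x => (a i j * re i j x - b i j * im i j x)%:E).
    have [ia ib] := int_ab i j.
    exact: integrableB ia ib.
  rewrite integral_sum // => [|i]; last exact: integrable_sum.
  apply: eq_bigr => i _; rewrite integral_sum //; apply: eq_bigr => j _.
  have [ia ib] := int_ab i j; have [ire iim] := integrable_mulJ i j.
  under eq_integral do rewrite EFinB.
  rewrite integralB_EFin //.
  by under eq_integral do rewrite EFinM; rewrite integralZl //;
     under [X in (_ - X)%E]eq_integral do rewrite EFinM; rewrite integralZl.
have reE i j : (\int[mu]_(x in D) (re i j x)%:E = ((i == j)%:R : R)%:E)%E.
  have [ire _] := integrable_mulJ i j.
  (* The integrals in [v_ortho] are [fine] values of extended ones; integrability makes the passage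
     faithful. *)
  rewrite -[LHS]fineK; last exact: integrable_fin_num.
  have /(congr1 (@complex.Re R)) /= := v_ortho i j.
  by rewrite /Rintegral => ->; case: (i == j).
have imE i j : (\int[mu]_(x in D) (im i j x)%:E = 0)%E.
  have [_ iim] := integrable_mulJ i j.
  rewrite -[LHS]fineK; last exact: integrable_fin_num.
  have /(congr1 (@complex.Im R)) /= := v_ortho i j.
  by rewrite /Rintegral => ->; case: (i == j).
rewrite -sumEFin; apply: eq_bigr => i _; rewrite (bigD1 i) //= reE imE eqxx.
rewrite big1 ?adde0 => [|j ji].
  rewrite mule0 sube0 mule1 /a /nsq; case: (c i) => p q /=.
  by rewrite mulrN opprK !expr2.
by rewrite reE imE eq_sym (negbTE ji) !mule0 sube0.
Qed.

End orthonormal.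

(** * The weighted Gram matrix of a sample and its inverse *)

Section gram.
Context {R : realType} d (T : measurableType d).
Variables (N : nat) (v : 'I_N -> T -> R[i]).

Definition kvec (x : T) : 'cV[R[i]]_N := \col_i v i x.

Definition kdiag (x : T) : R := \sum_i nsq (v i x).

(** The inverse of the density of the induced measure; it is 0 where the kernel vanishes, by the
    convention on division. *)
Definition weight (x : T) : R := N%:R / kdiag x.

(* The term 1/2 makes the Gram matrix of any sample invertible. *)
Fixpoint gram (Y : nat -> T) (m : nat) : 'M[R[i]]_N :=
  if m is m'.+1 then
    gram Y m' + (weight (Y m'))%:C *: (kvec (Y m') *m adjmx (kvec (Y m')))
  else (2^-1)%:C%:M.

Fixpoint gram_inv (Y : nat -> T) (m : nat) : 'M[R[i]]_N :=
  if m is m'.+1 then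
    rank_one_inv (weight (Y m')) (kvec (Y m')) (gram_inv Y m')
  else (2 : R)%:C%:M.

Lemma kdiag_ge0 x : 0 <= kdiag x.
Proof. by apply: sumr_ge0 => i _; exact: nsq_ge0. Qed.

Lemma kdiagE x : dot (kvec x) (kvec x) = kdiag x.
Proof. by rewrite dotxx; apply: eq_bigr => i _; rewrite mxE. Qed.

Lemma kvec_eq0 x : kdiag x = 0 -> kvec x = 0.
Proof.
move=> /eqP; rewrite psumr_eq0 => [/allP v0|i _]; last exact: nsq_ge0.
apply/colP => i; rewrite !mxE.
have := v0 i; rewrite mem_index_enum => /(_ isT) /=; rewrite -normc_sq.
by rewrite sqrf_eq0 => /eqP /eq0_normc.
Qed.

Lemma weight_ge0 x : 0 <= weight x.
Proof. by rewrite divr_ge0 // kdiag_ge0. Qed.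

Lemma weight_kdiag_le x : weight x * kdiag x <= N%:R.
Proof.
have [->|K0] := eqVneq (kdiag x) 0; first by rewrite mulr0.
by rewrite /weight divfK.
Qed.

Lemma gram_inverse_pair Y m : inverse_pair 2^-1 (gram Y m) (gram_inv Y m).
Proof.
elim: m => [|m IHm] /=; last first.
  by apply: inverse_pair_update => //; exact: weight_ge0.
have adj_scalar (a : R) : adjmx (a%:C%:M : 'M[R[i]]_N) = a%:C%:M.
  by apply/matrixP => i j; rewrite !mxE rmorphMn /= oppr0 eq_sym.
split; rewrite ?adj_scalar //.
  by rewrite -scalar_mxM -rmorphM mulVf // pnatr_eq0.
by move=> x; rewrite mul_scalar_mx dotZr.
Qed.

Lemma dot_gram Y m x : dot x (gram Y m *m x) = 2^-1 * dot x x +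
  \sum_(i < m) weight (Y i) * nsq ((adjmx (kvec (Y i)) *m x) 0 0).
Proof.
elim: m => [|m IHm] /=; first by rewrite mul_scalar_mx dotZr big_ord0 addr0.
rewrite mulmxDl dotDr IHm -addrA big_ord_recr /=; congr (_ + (_ + _)).
by rewrite -scalemxAl dotZr -mulmxA dot_adj dotxx big_ord1.
Qed.

Lemma frob_gram_inv0 Y : frob (gram_inv Y 0) = 4 * N%:R.
Proof.
rewrite /frob /=; under eq_bigr => i _.
  rewrite (bigD1 i) //= big1 ?addr0 => [|j ji]; last first.
    by rewrite mxE eq_sym (negbTE ji) /nsq /= expr0n addr0.
  rewrite mxE eqxx /nsq /= expr0n addr0.
  over.
by rewrite sumr_const card_ord -mulr_natr; ring.
Qed.

Hypothesis mv : forall i, cmeasurable (v i).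

Lemma measurable_kdiag : measurable_fun setT kdiag.
Proof. by apply: measurable_real_sum => i; exact: measurable_nsq. Qed.

Lemma measurable_weight : measurable_fun setT weight.
Proof.
apply: measurable_funM; first exact: measurable_cst.
by apply: measurable_inv measurable_kdiag; exact: kdiag_ge0.
Qed.

Definition mx_measurable d' (U : measurableType d') m n
  (A : U -> 'M[R[i]]_(m, n)) := forall i j, cmeasurable (fun u => A u i j).

Lemma mx_measurableM d' (U : measurableType d') m n p
    (A : U -> 'M[R[i]]_(m, n)) (B : U -> 'M[R[i]]_(n, p)) :
  mx_measurable A -> mx_measurable B -> mx_measurable (fun u => A u *m B u).
Proof.
move=> mA mB i j; under eq_fun do rewrite mxE.
by apply: cmeasurable_sum => k; exact: cmeasurableM.
Qed.

Lemma mx_measurableJ d' (U : measurableType d') m n (A : U -> 'M[R[i]]_(m, n)) :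
  mx_measurable A -> mx_measurable (fun u => adjmx (A u)).
Proof. by move=> mA i j; under eq_fun do rewrite !mxE; exact: cmeasurableJ. Qed.

Lemma cmeasurable_comp d' (U : measurableType d') (f : T -> R[i]) (g : U -> T) :
  cmeasurable f -> measurable_fun setT g -> cmeasurable (fun u => f (g u)).
Proof.
move=> [mre mim] mg; split.
  exact: (@measurableT_comp _ _ _ _ _ _ (fun x => complex.Re (f x) : R)).
exact: (@measurableT_comp _ _ _ _ _ _ (fun x => complex.Im (f x) : R)).
Qed.

Lemma measurable_frob d' (U : measurableType d') (A : U -> 'M[R[i]]_N) :
  mx_measurable A -> measurable_fun setT (fun u => frob (A u)).
Proof.
move=> mA; apply: measurable_real_sum => i; apply: measurable_real_sum => j.
exact: measurable_nsq.
Qed.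

Lemma mx_measurable_kvec d' (U : measurableType d') (g : U -> T) :
  measurable_fun setT g -> mx_measurable (fun u => kvec (g u)).
Proof.
move=> mg i j; under eq_fun do rewrite mxE; exact: (cmeasurable_comp (mv i) mg).
Qed.

(** Positivity of [A u] keeps the Sherman-Morrison denominator nonnegative, as [measurable_inv]
    requires. *)
Lemma mx_measurable_update d' (U : measurableType d') (g : U -> T)
    (A : U -> 'M[R[i]]_N) : (forall u x, 0 <= dot x (A u *m x)) ->
  measurable_fun setT g -> mx_measurable A ->
  mx_measurable (fun u => rank_one_inv (weight (g u)) (kvec (g u)) (A u)).
Proof.
move=> A0 mg mA.
have mk := mx_measurable_kvec mg.
have mAk := mx_measurableM mA mk.
have mw : measurable_fun setT (fun u => weight (g u)).
  exact: measurableT_comp measurable_weight mg.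
have md : measurable_fun setT (fun u => dot (kvec (g u)) (A u *m kvec (g u))).
  exact: (mx_measurableM (mx_measurableJ mk) mAk 0 0).1.
move=> i j; rewrite /rank_one_inv; under eq_fun do rewrite mxE mxE mxE.
apply: cmeasurableD => //; apply: cmeasurableN; apply: cmeasurableM; last first.
  exact: (mx_measurableM mAk (mx_measurableJ mAk)).
apply: cmeasurable_real; apply: measurable_funM => //.
apply: measurable_inv => [u|].
  by rewrite addr_ge0 // mulr_ge0 // weight_ge0.
by apply: measurable_funD => //; exact: measurable_funM.
Qed.

(** Any measurable space [U] is allowed, so that the result also gives measurability with respect to
    the past. *)
Lemma mx_measurable_gram_inv d' (U : measurableType d') (Z : nat -> U -> T) m :
  (forall i, (i < m)%N -> measurable_fun setT (Z i)) ->
  mx_measurable (fun u => gram_inv (fun i => Z i u) m).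
Proof.
elim: m => [|m IHm] mZ /=.
  by move=> i j; exact: cmeasurable_cst.
apply: mx_measurable_update; [|exact: mZ|].
  move=> u x; apply: inverse_pair_ge0; last exact: gram_inverse_pair.
  by rewrite invr_ge0.
by apply: IHm => i im; apply: mZ; exact: ltnW.
Qed.

End gram.

(** * Expectations over a single sample *)

Lemma expR_half_le (R : realType) (y : R) :
  0 <= y <= 1 -> expR (y / 2) <= 1 + y.
Proof.
move=> /andP[y0 y1].
have h : 0 < 1 - y / 2 by lra.
(* From exp(- y / 2) >= 1 - y / 2. What then remains, (1 + y)(1 - y / 2) >= 1, amounts to y (1 - y)
   >= 0. *)
have : expR (y / 2) <= (1 - y / 2)^-1.
  rewrite -[expR _]invrK -expRN lef_pV2 ?posrE ?expR_gt0 //.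
  exact: expR_ge1Dx.
move=> /le_trans; apply.
rewrite -(ler_pM2l h) divff ?gt_eqF //.
have := mulr_ge0 y0 (_ : 0 <= 1 - y); rewrite subr_ge0 => /(_ y1); lra.
Qed.

Section one_sample.
Context {R : realType} d (T : measurableType d) (mu nu : probability T R).
Variables (D : set T) (N : nat) (v : 'I_N -> T -> R[i]).
Hypothesis N0 : (0 < N)%N.
Hypothesis mD : measurable D.
Hypothesis mv : forall i, cmeasurable (v i).
Hypothesis v_lty : forall i, (\int[mu]_(x in D) (nsq (v i x))%:E < +oo)%E.
Hypothesis v_ortho : forall i j,
  ((\int[mu]_(x in D) complex.Re (v i x * (v j x)^*)) +i*
   (\int[mu]_(x in D) complex.Im (v i x * (v j x)^*)) : R[i]) = (i == j)%:R.
Hypothesis v0 : forall i x, ~ D x -> v i x = 0.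
Hypothesis K_ge1 : forall x, D x -> 1 <= kdiag v x.
Hypothesis nuE : forall A, measurable A ->
  (nu A = \int[mu]_(x in A) (N%:R^-1 * kdiag v x)%:E)%E.

Let N0R : 0 < N%:R :> R. Proof. by rewrite ltr0n. Qed.

Lemma kdiag_out x : ~ D x -> kdiag v x = 0.
Proof.
move=> Dx; rewrite /kdiag big1 // => i _.
by rewrite v0 // /nsq /= expr0n addr0.
Qed.

Lemma kdiag_inv_le1 x : 0 <= (kdiag v x)^-1 <= 1.
Proof.
rewrite invr_ge0 kdiag_ge0 /=; have [Dx|Dx] := pselect (D x).
  by rewrite invf_le1 ?K_ge1 // (lt_le_trans ltr01) ?K_ge1.
by rewrite kdiag_out // invr0.
Qed.

Lemma measurable_induced_density :
  measurable_fun setT (fun x => N%:R^-1 * kdiag v x).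
Proof. by apply: measurable_funM => //; exact: measurable_kdiag. Qed.

Lemma integral_induced (f : T -> R) : measurable_fun setT f ->
  (forall x, 0 <= f x) ->
  (\int[nu]_x (f x)%:E = \int[mu]_x (f x * (N%:R^-1 * kdiag v x))%:E)%E.
Proof.
move=> mf f0; rewrite (ge0_integral_density measurable_induced_density nuE) //.
exact/measurable_EFinP.
Qed.

Lemma measurable_dot_mulmx (A : 'M[R[i]]_N) :
  measurable_fun setT (fun x => dot (A *m kvec v x) (A *m kvec v x)).
Proof.
have mAk : mx_measurable (fun x => A *m kvec v x).
  apply: mx_measurableM => [i j|]; first exact: cmeasurable_cst.
  exact: (mx_measurable_kvec mv (@measurable_id _ _ setT)).
exact: (mx_measurableM (mx_measurableJ mAk) mAk 0 0).1.
Qed.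

(** The weight cancels the density, and Parseval applies to each row of [A]: the weighted outer
    products have mean the identity. *)
Lemma integral_induced_quadratic (A : 'M[R[i]]_N) :
  (\int[nu]_x (weight v x * dot (A *m kvec v x) (A *m kvec v x))%:E =
   (frob A)%:E)%E.
Proof.
rewrite integral_induced; last first.
- by move=> x; rewrite mulr_ge0 ?weight_ge0 ?dotxx_ge0.
- apply: measurable_funM; first exact: measurable_weight.
  exact: measurable_dot_mulmx.
have qE x : weight v x * dot (A *m kvec v x) (A *m kvec v x) *
    (N%:R^-1 * kdiag v x) = dot (A *m kvec v x) (A *m kvec v x).
  have [K0|K0] := eqVneq (kdiag v x) 0.
    by rewrite kvec_eq0 // mulmx0 dotxx big1 ?mulr0 ?mul0r // => i _;
       rewrite mxE /nsq /= expr0n addr0.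
  rewrite /weight; field.
  by rewrite K0 gt_eqF.
under eq_integral do rewrite qE.
transitivity (\int[mu]_(x in D) (\sum_i (nsq (\sum_j A i j * v j x))%:E))%E.
  rewrite [RHS]integral_mkcond; apply: eq_integral => x _.
  rewrite patchE; case: ifPn => [_|].
    by rewrite dotxx -sumEFin; apply: eq_bigr => i _; rewrite mxE;
       congr ((nsq _)%:E); apply: eq_bigr => j _; rewrite mxE.
  move=> /negP; rewrite inE => Dx; rewrite kvec_eq0 ?kdiag_out // mulmx0.
  by rewrite dotxx big1 // => i _; rewrite mxE /nsq /= expr0n addr0.
rewrite ge0_integral_sum //; last first.
- by move=> i x _; rewrite lee_fin nsq_ge0.
- move=> i; apply/measurable_EFinP/measurable_funTS/measurable_nsq.
  by apply: cmeasurable_sum => j; apply: cmeasurableM.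
under eq_bigr do rewrite (integral_nsq_sum mD mv v_lty v_ortho).
by rewrite sumEFin.
Qed.

Lemma measurable_kdiag_inv : measurable_fun setT (fun x => (kdiag v x)^-1).
Proof.
by apply: measurable_inv; [exact: kdiag_ge0|exact: measurable_kdiag].
Qed.

(** The density cancels 1 / K only where K is nonzero; elsewhere the integrand is 0, whence an
    inequality. *)
Lemma integral_induced_kdiag_inv :
  (\int[nu]_x ((kdiag v x)^-1)%:E <= (N%:R^-1)%:E)%E.
Proof.
rewrite integral_induced; [|exact: measurable_kdiag_inv|]; last first.
  by move=> x; rewrite invr_ge0 kdiag_ge0.
have -> : ((N%:R^-1 : R)%:E = \int[mu]_x (N%:R^-1)%:E)%E.
  by rewrite integral_cst //= probability_setT mule1.
apply: ge0_le_integral => //.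
- by move=> x _; rewrite lee_fin !mulr_ge0 ?invr_ge0 ?kdiag_ge0 // ltW.
- apply/measurable_EFinP; apply: measurable_funM.
    exact: measurable_kdiag_inv.
  exact: measurable_induced_density.
- move=> x _; rewrite lee_fin.
  have [->|K0] := eqVneq (kdiag v x) 0.
    by rewrite !mulr0 invr_ge0 ltW.
  by rewrite mulrCA mulVf // mulr1.
Qed.

Lemma integral_induced_expR :
  (\int[nu]_x (expR ((kdiag v x)^-1 / 2))%:E <= (1 + N%:R^-1)%:E)%E.
Proof.
have mKi : measurable_fun setT (fun x => ((kdiag v x)^-1)%:E).
  exact/measurable_EFinP/measurable_kdiag_inv.
apply: (@le_trans _ _ (\int[nu]_x (1 + (kdiag v x)^-1)%:E)%E).
  apply: ge0_le_integral => //.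
  - apply/measurable_EFinP; apply: (measurableT_comp (@measurable_expR R)).
    by apply: measurable_funM => //; exact: measurable_kdiag_inv.
  - apply/measurable_EFinP; apply: measurable_funD => //.
    exact: measurable_kdiag_inv.
  - by move=> x _; rewrite lee_fin expR_half_le // kdiag_inv_le1.
under eq_integral do rewrite EFinD.
rewrite ge0_integralD //; last first.
  by move=> x _; rewrite lee_fin invr_ge0 kdiag_ge0.
rewrite integral_cst //= probability_setT mul1e EFinD leeD2l //.
exact: integral_induced_kdiag_inv.
Qed.

(** Monotonicity bounds f'^2 by f f', and the second bound is applied to f' alone. The outcome is
    affine in [a], the only random quantity, whose mean will be [f]. *)
Lemma frob_sq_step (f f' a : R) (n : R) : 0 < n -> 0 <= f' -> f' <= f ->
  f' <= f - (a - n^-1) / (2 * n) ->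
  f' ^+ 2 + f / (2 * n) * a <= f ^+ 2 + f / (2 * n ^+ 2).
Proof.
move=> n0 f'0 f'f f'a.
have f0 : 0 <= f by exact: le_trans f'f.
apply: (@le_trans _ _ (f * (f - (a - n^-1) / (2 * n)) + f / (2 * n) * a)).
  by rewrite lerD2r expr2 ler_pM.
rewrite le_eqVlt; apply/orP; left; apply/eqP.
by field; rewrite gt_eqF.
Qed.

Lemma integral_induced_frob (S A : 'M[R[i]]_N) : inverse_pair 2^-1 S A ->
  (\int[nu]_x (frob (rank_one_inv (weight v x) (kvec v x) A) ^+ 2)%:E <=
   ((1 - (4 * N%:R)^-1) * frob A ^+ 2 + (4 * N%:R ^+ 3)^-1)%:E)%E.
Proof.
move=> SA; set n : R := N%:R; set f := frob A.
have f0 : 0 <= f by exact: frob_ge0.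
pose f' x := frob (rank_one_inv (weight v x) (kvec v x) A).
pose q x := weight v x * dot (A *m kvec v x) (A *m kvec v x).
have half0 : (0 : R) <= 2^-1 by rewrite invr_ge0.
have mf' : measurable_fun setT f'.
  apply: measurable_frob; apply: mx_measurable_update => //.
  by move=> _ x; exact: inverse_pair_ge0 half0 SA x.
have mq : measurable_fun setT q.
  apply: measurable_funM; first exact: measurable_weight.
  exact: measurable_dot_mulmx.
have q0 x : 0 <= q x by rewrite mulr_ge0 ?weight_ge0 ?dotxx_ge0.
have b0 : 0 <= f / (2 * n) by rewrite divr_ge0 // mulr_ge0 // ltW.
have : (\int[nu]_x (f' x ^+ 2)%:E + (f / (2 * n) * f)%:E <=
        (f ^+ 2 + f / (2 * n ^+ 2))%:E)%E.
  (* One factor [f] is the mean of [q]; both sides become integrals, to be compared pointwise by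
     [frob_sq_step]. *)
  rewrite [X in (_ + X)%E]EFinM -[X in (_ + _ * X)%E]integral_induced_quadratic.
  rewrite -ge0_integralZl_EFin //; first last.
  - exact/measurable_EFinP.
  - by move=> x _; rewrite lee_fin q0.
  rewrite -ge0_integralD //; last 4 first.
  - by move=> x _; rewrite lee_fin sqr_ge0.
  - by apply/measurable_EFinP; exact: measurable_funX.
  - by move=> x _; rewrite -EFinM lee_fin mulr_ge0 ?q0.
  - by apply: emeasurable_funM => //; exact/measurable_EFinP.
  have -> : ((f ^+ 2 + f / (2 * n ^+ 2))%:E =
      \int[nu]_x (f ^+ 2 + f / (2 * n ^+ 2))%:E)%E.
    by rewrite integral_cst //= probability_setT mule1.
  apply: ge0_le_integral => //.
  - by move=> x _; rewrite adde_ge0 ?mule_ge0 ?lee_fin ?sqr_ge0 ?q0.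
  - apply: emeasurable_funD.
      by apply/measurable_EFinP; exact: measurable_funX.
    by apply: emeasurable_funM => //; exact/measurable_EFinP.
  - move=> x _; rewrite -EFinM -EFinD lee_fin.
    have w_le : weight v x * dot (kvec v x) (kvec v x) <= n.
      by rewrite kdiagE; exact: weight_kdiag_le.
    have [le1 le2] := frob_rank_one_inv_le half0 SA (weight_ge0 v x) N0R w_le.
    by apply: frob_sq_step => //; exact: frob_ge0.
rewrite -leeBrDr // -EFinB => /le_trans; apply; rewrite lee_fin.
(* The two sides differ by exactly this square, which trades the linear term f / (2 n^2) for f^2 /
   (4 n) and a constant. *)
have : 0 <= (f - n^-1) ^+ 2 / (4 * n).
  by rewrite divr_ge0 ?sqr_ge0 // mulr_ge0 // ltW.
rewrite -subr_ge0 => h; rewrite -subr_ge0; apply: le_trans h _.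
rewrite le_eqVlt; apply/orP; left; apply/eqP.
by field; rewrite gt_eqF.
Qed.

End one_sample.

(** * Markov's inequality and recursions along the sampling process *)

Lemma measurable_superlevel d (T : measurableType d) (R : realType) (f : T -> R)
  (a : R) : measurable_fun setT f -> measurable [set x | a <= f x].
Proof.
move=> mf; have -> : [set x | a <= f x] = setT `&` f @^-1` `[a, +oo[%classic.
  by rewrite setTI; apply/seteqP; split=> x /=; rewrite in_itv /= andbT.
by apply: mf.
Qed.

Lemma markov_real d (T : measurableType d) (R : realType)
    (P : probability T R) (f : T -> R) (e b : R) : 0 < e ->
  measurable_fun setT f -> (forall x, 0 <= f x) ->
  (\int[P]_x (f x)%:E <= b%:E)%E ->
  (P [set x | e <= f x]%R <= (b / e)%:E)%E.
Proof.
move=> e0 mf f0 fb.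
have mEf : measurable_fun setT (fun x => (f x)%:E) by exact/measurable_EFinP.
have := le_integral_abse P measurableT mEf e0.
rewrite setTI; under eq_integral do rewrite abse_EFin ger0_norm //.
have -> : [set x | (e%:E <= `|(f x)%:E|)%E] = [set x | e <= f x].
  by apply/seteqP; split=> x /=; rewrite ger0_norm // lee_fin.
move=> h; rewrite mulrC EFinM lee_pdivlMl //; exact: le_trans h fb.
Qed.

(** Since [a * y + b <= y], the excess over [y] shrinks by the factor [a] at each step. With
    extended real values, finiteness of the expectations need not be proved beforehand. *)
Lemma geometric_recursion (R : realType) (E : nat -> \bar R) (a b y M0 : R)
    (M : nat) : 0 <= a -> a * y + b <= y -> (E 0%N <= (M0 + y)%:E)%E ->
  (forall m, (m < M)%N -> (E m.+1 <= a%:E * E m + b%:E)%E) ->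
  forall m, (m <= M)%N -> (E m <= (a ^+ m * M0 + y)%:E)%E.
Proof.
move=> a0 aby E0 ES; elim=> [_|m IHm mM]; first by rewrite expr0 mul1r.
apply: le_trans (ES m mM) _.
apply: (@le_trans _ _ (a%:E * (a ^+ m * M0 + y)%:E + b%:E)%E).
  by rewrite leeD2r // lee_wpmul2l ?lee_fin // IHm // ltnW.
rewrite -EFinM -EFinD lee_fin exprS mulrDr -addrA mulrA lerD2l.
exact: aby.
Qed.

Section process.
Context d d' (Omega : measurableType d) (T : measurableType d') (R : realType).
Variables (P : probability Omega R) (nu : probability T R).
Variables (Y : nat -> {mfun Omega >-> T}) (M : nat).
Hypothesis indep : forall n B, (n <= M)%N -> (forall i, measurable (B i)) ->
  P (\bigcap_(i < n) Y i @^-1` B i) = (\prod_(i < n) P (Y i @^-1` B i))%E.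
Hypothesis law : forall m C, (m < M)%N -> measurable C ->
  P (Y m @^-1` C) = nu C.

Lemma measurable_from_past m d2 (U : measurableType d2)
    (h : g_sigma_algebraType (past_events Y m) -> U) :
  measurable_fun setT h -> measurable_fun setT (h : Omega -> U).
Proof.
move=> mh _ B mB; rewrite setTI; apply: (@past_measurable _ _ _ _ Y m).
by rewrite -[X in measurable X]setTI; exact: mh.
Qed.

Lemma expectation_step m (g : g_sigma_algebraType (past_events Y m) * T -> R)
    (h : g_sigma_algebraType (past_events Y m) -> R) (a b : R) : (m < M)%N ->
  measurable_fun setT g -> (forall z, 0 <= g z) ->
  measurable_fun setT h -> (forall w, 0 <= h w) -> 0 <= a -> 0 <= b ->
  (forall w, \int[nu]_x (g (w, x))%:E <= (a * h w + b)%:E)%E ->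
  (\int[P]_w (g (w, Y m w))%:E <= a%:E * \int[P]_w (h w)%:E + b%:E)%E.
Proof.
move=> mM mg g0 mh h0 a0 b0 gh.
have mEg : measurable_fun setT (fun z => (g z)%:E) by exact/measurable_EFinP.
have mh' := measurable_from_past mh.
rewrite (@expectation_past _ _ _ _ _ P Y m _ nu _ (fun z => (g z)%:E)) //;
  last 2 first.
- by move=> n B nm; apply: indep; exact: leq_trans nm mM.
- by move=> C; exact: law.
rewrite -ge0_integralZl_EFin //; last first.
- exact/measurable_EFinP.
- by move=> w _; rewrite lee_fin h0.
have -> : (b%:E = \int[P]_w b%:E)%E.
  by rewrite integral_cst //= probability_setT mule1.
rewrite -ge0_integralD //; first last.
- exact/measurable_EFinP/measurable_funM.
- by move=> w _; rewrite -EFinM lee_fin mulr_ge0.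
apply: ge0_le_integral => //.
- by move=> w _; apply: integral_ge0 => x _; rewrite lee_fin.
- apply: (@measurable_from_past m).
  apply: (measurable_fun_fubini_tonelli_F (m2 := nu) _ mEg) => z.
  by rewrite lee_fin.
- by apply: emeasurable_funD => //; exact/measurable_EFinP/measurable_funM.
Qed.

End process.

(** * The probability of a bad sample *)

Section sampling.
Context {R : realType} d (T : measurableType d) (mu nu : probability T R).
Variables (D : set T) (N : nat) (v : 'I_N -> T -> R[i]).
Hypothesis N0 : (0 < N)%N.
Hypothesis mD : measurable D.
Hypothesis mv : forall i, cmeasurable (v i).
Hypothesis v_lty : forall i, (\int[mu]_(x in D) (nsq (v i x))%:E < +oo)%E.
Hypothesis v_ortho : forall i j,
  ((\int[mu]_(x in D) complex.Re (v i x * (v j x)^*)) +i*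
   (\int[mu]_(x in D) complex.Im (v i x * (v j x)^*)) : R[i]) = (i == j)%:R.
Hypothesis v0 : forall i x, ~ D x -> v i x = 0.
Hypothesis K_ge1 : forall x, D x -> 1 <= kdiag v x.
Hypothesis nuE : forall A, measurable A ->
  (nu A = \int[mu]_(x in A) (N%:R^-1 * kdiag v x)%:E)%E.
Context d' (Omega : measurableType d') (P : probability Omega R).
Variables (Y : nat -> {mfun Omega >-> T}) (M : nat).
Hypothesis indep : forall n B, (n <= M)%N -> (forall i, measurable (B i)) ->
  P (\bigcap_(i < n) Y i @^-1` B i) = (\prod_(i < n) P (Y i @^-1` B i))%E.
Hypothesis law : forall m C, (m < M)%N -> measurable C ->
  P (Y m @^-1` C) = nu C.

Let N0R : 0 < N%:R :> R. Proof. by rewrite ltr0n. Qed.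

Let G m (w : Omega) := gram_inv v (fun i => Y i w) m.
Let L m (w : Omega) := \sum_(i < m) (kdiag v (Y i w))^-1.

Let half0 : (0 : R) <= 2^-1. Proof. by rewrite invr_ge0. Qed.

Lemma measurable_gram_inv_past m :
  mx_measurable (G m : g_sigma_algebraType (past_events Y m) -> _).
Proof.
by apply: mx_measurable_gram_inv => // i im; exact: measurable_past.
Qed.

(** N^-2 is the fixed point of the one-sample recursion, and the starting value is (4 N)^2. *)
Lemma expectation_frob m : (m <= M)%N ->
  (\int[P]_w (frob (G m w) ^+ 2)%:E <=
   ((1 - (4 * N%:R)^-1) ^+ m * (16 * N%:R ^+ 2) + (N%:R ^+ 2)^-1)%:E)%E.
Proof.
have inv_ge0 : (0 : R) <= (4 * N%:R ^+ 3)^-1.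
  by rewrite invr_ge0 mulr_ge0 // exprn_ge0 // ltW.
have a_ge0 : 0 <= 1 - (4 * N%:R)^-1 :> R.
  rewrite subr_ge0 invf_le1 ?mulr_gt0 // -natrM ler1n.
  by rewrite muln_gt0.
move: m; apply: (@geometric_recursion R _ (1 - (4 * N%:R)^-1)
  (4 * N%:R ^+ 3)^-1) => //.
- by rewrite le_eqVlt; apply/orP; left; apply/eqP; field; rewrite gt_eqF.
- rewrite /G; under eq_integral do rewrite frob_gram_inv0.
  rewrite integral_cst //= probability_setT mule1 lee_fin.
  have -> : (4 * N%:R) ^+ 2 = 16 * N%:R ^+ 2 :> R by ring.
  by rewrite lerDl invr_ge0 sqr_ge0.
- move=> k kM; pose g (z : g_sigma_algebraType (past_events Y k) * T) : R :=
    frob (rank_one_inv (weight v z.2) (kvec v z.2) (G k z.1)) ^+ 2.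
  apply: (@expectation_step _ _ _ _ _ P nu Y M indep law k g
    (fun w => frob (G k w) ^+ 2)) => //.
  + apply: measurable_funX; apply: measurable_frob.
    apply: mx_measurable_update => //.
      move=> z x; apply: inverse_pair_ge0; last exact: gram_inverse_pair.
      exact: half0.
    move=> i j.
    exact: (cmeasurable_comp (measurable_gram_inv_past k i j) measurable_fst).
  + by move=> z; rewrite sqr_ge0.
  + apply: measurable_funX; apply: measurable_frob.
    exact: measurable_gram_inv_past.
  + by move=> w; rewrite sqr_ge0.
  + move=> w; have pair := gram_inverse_pair v (fun i => Y i w) k.
    exact: (integral_induced_frob N0 mD mv v_lty v_ortho v0 nuE pair).
Qed.

Lemma measurable_L_past m :
  measurable_fun setT (L m : g_sigma_algebraType (past_events Y m) -> R).
Proof.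
apply: measurable_real_sum => i.
apply: (measurableT_comp (measurable_kdiag_inv mv)).
exact: measurable_past.
Qed.

(** Each sample multiplies the exponential moment by at most 1 + 1/N; this is the recursion with [b]
    and [y] equal to 0. *)
Lemma expectation_expR m : (m <= M)%N ->
  (\int[P]_w (expR (L m w / 2))%:E <= ((1 + N%:R^-1) ^+ m)%:E)%E.
Proof.
have a_ge0 : 0 <= 1 + N%:R^-1 :> R by rewrite addr_ge0 // invr_ge0 ltW.
move=> mM; have -> : (1 + N%:R^-1) ^+ m = (1 + N%:R^-1) ^+ m * 1 + 0 :> R.
  by rewrite mulr1 addr0.
move: m mM; apply: (@geometric_recursion R _ (1 + N%:R^-1) 0 0 1 M) => //.
- rewrite /L; under eq_integral do rewrite big_ord0 mul0r expR0.
  by rewrite integral_cst //= probability_setT mule1 addr0.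
- move=> k kM; pose g (z : g_sigma_algebraType (past_events Y k) * T) : R :=
    expR (L k z.1 / 2) * expR ((kdiag v z.2)^-1 / 2).
  have gE w : expR (L k.+1 w / 2) = g (w, Y k w).
    by rewrite /g /= -expRD -mulrDl /L big_ord_recr.
  under eq_integral do rewrite gE.
  have mexp c d2 (U : measurableType d2) (f : U -> R) : measurable_fun setT f ->
    measurable_fun setT (fun u => expR (f u / c)).
    move=> mf; apply: (measurableT_comp (@measurable_expR R)).
    exact: measurable_funM.
  apply: (@expectation_step _ _ _ _ _ P nu Y M indep law k g
    (fun w => expR (L k w / 2))) => //.
  + apply: measurable_funM; apply: mexp.
      exact: (measurableT_comp (@measurable_L_past k) measurable_fst).
    exact: (measurableT_comp (measurable_kdiag_inv mv) measurable_snd).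
  + by move=> z; rewrite mulr_ge0 ?expR_ge0.
  + apply: (@mexp 2 _ (g_sigma_algebraType (past_events Y k)) (L k)).
    exact: measurable_L_past.
  + move=> w; rewrite /g /=; under eq_integral do rewrite EFinM.
    rewrite ge0_integralZl_EFin ?expR_ge0 //; last first.
      by apply/measurable_EFinP/mexp/measurable_kdiag_inv.
    rewrite addr0 (mulrC (1 + N%:R^-1)) EFinM lee_wpmul2l ?lee_fin ?expR_ge0 //.
    exact: (integral_induced_expR N0 mv v0 K_ge1 nuE).
Qed.

Hypothesis hM : 16 * N%:R * ln N%:R <= M%:R :> R.

(** Both conditions have the form to which Markov's inequality applies; the second one says that
    [L M w] is at least 4 M / N. *)
Definition bad_event : set Omega :=
  [set w | 1 <= frob (G M w) ^+ 2] `|`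
  [set w | expR (2 * M%:R / N%:R) <= expR (L M w / 2)].

Lemma bad_event_measurable_bound : measurable bad_event /\
  (P bad_event <= (18 * (N%:R ^+ 2)^-1)%:E)%E.
Proof.
have mfrob : measurable_fun setT (fun w => frob (G M w) ^+ 2).
  apply: (@measurable_from_past _ _ _ _ Y M).
  apply: measurable_funX; apply: measurable_frob.
  exact: measurable_gram_inv_past.
have mexp : measurable_fun setT (fun w => expR (L M w / 2)).
  apply: (@measurable_from_past _ _ _ _ Y M).
  apply: (measurableT_comp (@measurable_expR R)).
  by apply: measurable_funM => //; exact: measurable_L_past.
have m1 : measurable [set w | 1 <= frob (G M w) ^+ 2].
  exact: measurable_superlevel.
have m2 : measurable [set w | expR (2 * M%:R / N%:R) <= expR (L M w / 2)].
  exact: measurable_superlevel.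
split; first exact: measurableU.
have N2 : (N%:R ^+ 2)^-1 = expR (- (2 * ln N%:R)) :> R.
  by rewrite expRN expRM_natl lnK // posrE.
have MN : 16 * ln N%:R <= M%:R / N%:R :> R.
  by rewrite ler_pdivlMr // mulrAC.
have lnN : 0 <= ln N%:R :> R by rewrite ln_ge0 // ler1n.
apply: le_trans (measureU2 _ m1 m2) _.
(* The first event receives 17, from 16 N^2 N^-4 + N^-2, and the second one receives 1. *)
have -> : 18 * (N%:R ^+ 2)^-1 =
    17 * (N%:R ^+ 2)^-1 + (N%:R ^+ 2)^-1 :> R by ring.
rewrite EFinD; apply: leeD.
- apply: le_trans (markov_real ltr01 mfrob _ (expectation_frob (leqnn M))) _.
    by move=> w; rewrite sqr_ge0.
  rewrite lee_fin divr1.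
  (* At most exp(- M / (4 N)) <= exp(- 4 ln N): the factor 16 in [hM] is what beats the starting
     value 16 N^2. *)
  have h : (1 - (4 * N%:R)^-1) ^+ M <= (N%:R ^+ 2)^-1 ^+ 2 :> R.
    apply: (@le_trans _ _ (expR (- (4 * N%:R)^-1) ^+ M)).
      apply: lerXn2r; rewrite ?nnegrE ?expR_ge0 //; last exact: expR_ge1Dx.
      rewrite subr_ge0 invf_le1 ?mulr_gt0 // -natrM ler1n.
      by rewrite muln_gt0.
    rewrite N2 -!expRM_natl ler_expR.
    have -> : M%:R * - (4 * N%:R)^-1 = - (M%:R / N%:R) / 4 :> R.
      by field; rewrite gt_eqF.
    move: MN; set z := M%:R / N%:R; move: (ln _) => l; lra.
  have -> : 17 * (N%:R ^+ 2)^-1 =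
      (N%:R ^+ 2)^-1 ^+ 2 * (16 * N%:R ^+ 2) + (N%:R ^+ 2)^-1 :> R.
    by field; rewrite gt_eqF.
  by rewrite lerD2r ler_wpM2r // mulr_ge0 // sqr_ge0.
- have EM := expectation_expR (leqnn M).
  apply: le_trans (markov_real (expR_gt0 _) mexp _ EM) _.
    by move=> w; rewrite expR_ge0.
  rewrite lee_fin -expRN.
  (* As (1 + 1/N)^M <= exp(M / N), Markov leaves exp(- M / N), which is at most N^-16. *)
  apply: (@le_trans _ _ (expR (N%:R^-1) ^+ M * expR (- (2 * M%:R / N%:R)))).
    apply: ler_wpM2r; first exact: expR_ge0.
    apply: lerXn2r; rewrite ?nnegrE ?expR_ge0 ?addr_ge0 ?invr_ge0 ?(ltW N0R) //.
    exact: expR_ge1Dx.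
  rewrite -expRM_natl -expRD N2 ler_expR.
  have -> : M%:R * N%:R^-1 - 2 * M%:R / N%:R = - (M%:R / N%:R) :> R by ring.
  move: MN lnN; set z := M%:R / N%:R; move: (ln _) => l; lra.
Qed.

Lemma not_bad_event w : ~ bad_event w ->
  frob (G M w) <= 1 /\ L M w <= 4 * M%:R / N%:R.
Proof.
move=> /not_orP[/negP h1 /negP h2]; split.
  rewrite leNgt; apply/negP => h; case/negP: h1.
  by rewrite expr_ge1 ?frob_ge0 // ltW.
move: h2; rewrite -ltNge ltr_expR => /ltW; lra.
Qed.

End sampling.

(** * From the Gram matrix to a norming inequality *)

Section norming.
Context {R : realType} d (T : measurableType d).
Variables (N : nat) (v : 'I_N -> T -> R[i]).

Lemma nsq_sum_kdiag_le (c : 'I_N -> R[i]) x :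
  nsq (\sum_i c i * v i x) <= (\sum_i nsq (c i)) * kdiag v x.
Proof. exact: nsq_sum_le. Qed.

(** The lower bound S >= 1 reads |c|^2 <= |c|^2 / 2 + t, where t is the weighted sum of squares over
    the sample. With weights N / K and the bound on the sum of the 1 / K, t <= 4 M b, so |c|^2 <= 8
    M b. *)
Lemma norming_bound (Y : nat -> T) (M : nat) (c : 'I_N -> R[i]) (b : R) :
  frob (gram_inv v Y M) <= 1 ->
  \sum_(i < M) (kdiag v (Y i))^-1 <= 4 * M%:R / N%:R ->
  (forall i, (i < M)%N -> nsq (\sum_j c j * v j (Y i)) <= b) ->
  forall x, nsq (\sum_j c j * v j x) <= 8 * M%:R * b * kdiag v x.
Proof.
move=> frob1 sumK cb x.
apply: le_trans (nsq_sum_kdiag_le c x) _; apply: ler_wpM2r.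
  exact: kdiag_ge0.
have [N0|N0] := posnP N.
  have -> : \sum_i nsq (c i) = 0 
    by apply: big1 => i _; have := ltn_ord i; rewrite [X in (_ < X)%N]N0.
  case: M {frob1 sumK} cb => [|m] cb; first by rewrite mulr0 mul0r.
  by rewrite !mulr_ge0 // (le_trans _ (cb 0%N isT)) // nsq_ge0.
(* With conjugated coefficients, k(x)^* z is the conjugate of the function value at x. *)
pose z : 'cV[R[i]]_N := \col_i (c i)^*.
have zz : dot z z = \sum_i nsq (c i).
  by rewrite dotxx; apply: eq_bigr => i _; rewrite mxE nsqJ.
have half0 : (0 : R) <= 2^-1 by rewrite invr_ge0.
have := inverse_pair_lower_bound half0 (gram_inverse_pair v Y M) z frob1.
rewrite dot_gram zz; set s := \sum_i nsq (c i); set t := (X in _ + X) => st.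
have t_le : t <= \sum_(i < M) N%:R * b * (kdiag v (Y i))^-1.
  apply: ler_sum => i _; rewrite /weight [leRHS]mulrAC -!mulrA.
  apply: ler_wpM2l => //; apply: ler_wpM2l; first by rewrite invr_ge0 kdiag_ge0.
  apply: le_trans (cb i (ltn_ord i)); rewrite -nsqJ mxE rmorph_sum.
  rewrite le_eqVlt; apply/orP; left; apply/eqP; congr nsq.
  apply: eq_bigr => j _; rewrite !mxE.
  by rewrite (rmorphM conjc) /= !conjcK mulrC.
have b0 : (0 < M)%N -> 0 <= b.
  by move=> M0; apply: le_trans (cb 0%N M0); exact: nsq_ge0.
have : t <= 4 * M%:R * b.
  apply: le_trans t_le _; rewrite -mulr_sumr.
  have [M0|M0] := posnP M.
    rewrite [X in _ * X]big1 => [|i _].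
      by rewrite M0 !mulr0 mul0r.
    by have := ltn_ord i; rewrite [X in (_ < X)%N]M0.
  apply: le_trans (ler_wpM2l _ sumK) _; first by rewrite mulr_ge0 // b0.
  rewrite le_eqVlt; apply/orP; left; apply/eqP.
  by field; rewrite pnatr_eq0 -lt0n.
lra.
Qed.

End norming.

(** * Estimates for the sample size, the limit superior and inverse squares *)

Section sample_size.
Context {R : realType}.

Lemma sample_size_ge N : (0 < N)%N ->
  25 * N%:R * ln N%:R <= (sample_size R N)%:R :> R.
Proof.
move=> N0; have lnN : 0 <= ln N%:R :> R by rewrite ln_ge0 // ler1n.
rewrite natr_absz ger0_norm ?ceil_ge // ceil_ge0 (lt_le_trans (ltrN10 R)) //.
by rewrite !mulr_ge0.
Qed.

Lemma sample_size_le N : (0 < N)%N ->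
  (sample_size R N)%:R <= 25 * N%:R * ln N%:R + 1 :> R.
Proof.
move=> N0; have lnN : 0 <= ln N%:R :> R by rewrite ln_ge0 // ler1n.
rewrite natr_absz ger0_norm; last first.
  by rewrite ceil_ge0 (lt_le_trans (ltrN10 R)) // !mulr_ge0.
have := ceilB1_lt (25 * N%:R * ln N%:R : R).
by rewrite intrD ltrBlDr => /ltW.
Qed.

Lemma sample_size_gt0 N : (1 < N)%N -> (0 < sample_size R N)%N.
Proof.
move=> N1; have N0 := ltnW N1; rewrite -(ltr_nat R).
apply: lt_le_trans (sample_size_ge N0).
by rewrite !mulr_gt0 // ?ltr0n // ln_gt0 // ltr1n.
Qed.

(** The logarithm is absorbed by ln N = ln(N^tau) / tau <= N^tau / tau, whence 25 / tau; the summand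
    1 pays for rounding up. *)
Lemma sample_size_powR (tau : R) N : 0 < tau -> (0 < N)%N ->
  (sample_size R N)%:R <= (25 / tau + 1) * N%:R `^ (1 + tau).
Proof.
move=> tau0 N0; apply: le_trans (sample_size_le N0) _.
have NR : 1 <= N%:R :> R by rewrite ler1n.
have NR0 : 0 < N%:R :> R by rewrite ltr0n.
have lnN : ln N%:R <= N%:R `^ tau / tau.
  by rewrite ler_pdivlMr // mulrC -ln_powR ltW // ln_sublinear // powR_gt0.
rewrite [leRHS]mulrDl [X in _ <= _ + X]mul1r; apply: lerD.
  rewrite powRD ?(gt_eqF NR0) ?implybT // powRr1 ?(ltW NR0) //.
  have -> : 25 / tau * (N%:R * N%:R `^ tau) =
      25 * N%:R * (N%:R `^ tau / tau) :> R.
    by field; rewrite gt_eqF.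
  by apply: ler_wpM2l lnN; rewrite mulr_ge0.
rewrite -[leLHS](powRr0 N%:R); apply: ler_powR => //.
by rewrite addr_ge0 // ltW.
Qed.

End sample_size.

Lemma limn_esup_lt_eventually (R : realType) (u : nat -> \bar R) (x : \bar R) :
  (limn_esup u < x)%E -> exists n0, forall n, (n0 <= n)%N -> (u n < x)%E.
Proof.
rewrite limn_esup_lim (cvg_lim _ (@cvg_esups_inf _ u)) //.
move=> /ereal_inf_lt[_ [n0 _ <-] ux]; exists n0 => n n0n.
by apply: le_lt_trans ux; apply: ereal_sup_ubound; exists n.
Qed.

(** Telescoping: 1 / a^2 <= 2 / a - 2 / (a + 1) for every a >= 1. *)
Lemma inv_sq_summable (R : realType) (u : nat -> \bar R) (c : R) : 0 <= c ->
  (forall n, 0 <= u n)%E -> (forall n, (u n <= (c * (n.+1%:R ^+ 2)^-1)%:E)%E) ->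
  (\sum_(n <oo) u n < +oo)%E.
Proof.
move=> c0 u0 uc.
have part n : (\sum_(0 <= k < n) u k <= (c * (2 - 2 * n.+1%:R^-1))%:E)%E.
  elim: n => [|n IHn].
    by rewrite big_nil lee_fin invr1 mulr1 subrr mulr0.
  rewrite big_nat_recr //=; apply: le_trans (leeD IHn (uc n)) _.
  rewrite -EFinD lee_fin -mulrDr ler_wpM2l //.
  have n1 : 1 <= n.+1%:R :> R by rewrite ler1n.
  have n1_gt0 : 0 < n.+1%:R :> R by rewrite ltr0n.
  rewrite -[n.+2]addn1 natrD; move: n1 n1_gt0; set a : R := n.+1%:R => a1 a0.
  have a10 : 0 < a + 1 by rewrite addr_gt0.
  rewrite -subr_ge0.
  have -> : 2 - 2 * (a + 1)^-1 - (2 - 2 * a^-1 + (a ^+ 2)^-1) =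
      (a - 1) / (a ^+ 2 * (a + 1)).
    by field; rewrite !gt_eqF.
  by rewrite divr_ge0 ?subr_ge0 // mulr_ge0 ?sqr_ge0 // ltW.
apply: (@le_lt_trans _ _ (c * 2)%:E); last exact: ltry.
apply: lime_le; first exact: is_cvg_nneseries.
apply: nearW => n; apply: le_trans (part n) _; rewrite lee_fin ler_wpM2l //.
by rewrite gerBl mulr_ge0 // invr_ge0.
Qed.

(** * The sampling estimate for a single space *)

Section one_level.
Context {R : realType} {d : nat} (mu : probability (borel_space R d) R).
Local Notation E := (borel_space R d).
Local Notation D := (msupport mu).

Lemma measurable_msupport : measurable (D : set E).
Proof.
rewrite -[D]setCK; apply: measurableC; apply: sub_sigma_algebra.
have -> : ~` D =
    \bigcup_(U in [set U : set 'rV[R]_d | open U /\ ~ (0 < mu U)%E]) U.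
  apply/seteqP; split=> [x /= /existsNP[U /not_implyP[oU /not_implyP[Ux U0]]]|].
    by exists U.
  by move=> x [U [oU U0] Ux] /(_ U oU Ux).
by apply: bigcup_open => U [].
Qed.

Context (V : set (E -> R[i])) (N : nat) (v : 'I_N -> E -> R[i]).
Hypothesis V_sub : L2_subspace mu V.
Hypothesis v_basis : orthonormal_basis mu V v.
Hypothesis V1 : V (\1_D).
Hypothesis N1 : (1 < N)%N.
Let M := sample_size R N.
Context d' {Omega : measurableType d'} (P : probability Omega R).
Variable X : 'I_M -> {RV P >-> E}.
Hypothesis X_indep : mutually_independent P (fun m => X m : Omega -> _).
Hypothesis X_dist : forall m A, measurable A ->
  distribution P (X m) A = induced_measure mu v A.

Let v_in i : L2_support mu (v i).
Proof. by have [Vs _ _] := V_sub; have [Vv _ _] := v_basis; exact: Vs. Qed.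

Let mv i : cmeasurable (v i). Proof. by have [] := v_in i; split. Qed.

Let v0 i x : ~ D x -> v i x = 0. Proof. by have [+ _ _ _] := v_in i; apply. Qed.

Let v_lty i : (\int[mu]_(x in D) (nsq (v i x))%:E < +oo)%E.
Proof.
have [_ _ _] := v_in i; congr (_ < _)%E.
by apply: eq_integral => x _; rewrite normc_sq.
Qed.

Let v_ortho i j :
  ((\int[mu]_(x in D) complex.Re (v i x * (v j x)^*)) +i*
   (\int[mu]_(x in D) complex.Im (v i x * (v j x)^*)) : R[i]) = (i == j)%:R.
Proof. by have [_ + _] := v_basis; apply. Qed.

Lemma kernel_diagE x : kernel_diag v x = kdiag v x.
Proof. by apply: eq_bigr => i _; rewrite normc_sq. Qed.

(** Expand the constant 1 in the basis: 1 <= |c|^2 K(x) by Cauchy-Schwarz, and |c|^2 = mu(D) <= 1 by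
    Parseval. *)
Lemma kernel_diag_ge1 x : D x -> 1 <= kdiag v x.
Proof.
move=> Dx; have [_ _ /(_ _ V1)[c cE]] := v_basis.
have := integral_nsq_sum measurable_msupport mv v_lty v_ortho c.
rewrite (eq_integral (fun=> 1%E)) => [|y Dy]; last first.
  rewrite -(congr1 (@^~ y) cE) indicE Dy.
  by rewrite /nsq /= expr1n expr0n addr0.
rewrite integral_cst ?mul1e; last exact: measurable_msupport.
move=> muD; have c1 : \sum_i nsq (c i) <= 1.
  by rewrite -lee_fin -muD; exact: probability_le1 measurable_msupport.
have : nsq (\1_D x : R[i]) = 1.
  by rewrite indicE mem_set // /nsq /= expr1n expr0n addr0.
rewrite (congr1 (@^~ x) cE) => <-.
apply: le_trans (nsq_sum_kdiag_le v c x) _.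
by rewrite -[leRHS]mul1r ler_wpM2r // kdiag_ge0.
Qed.

Let i0 : 'I_M := Ordinal (sample_size_gt0 N1).
(** The sample as an infinite sequence. From index [M] on it repeats [X i0], so independence is
    claimed for the first [M] terms only. *)
Let Y (i : nat) : {mfun Omega >-> E} := X (insubd i0 i).

(** Extension by zero makes the density vanish off the support. *)
Lemma sample_in_support m : P (X m @^-1` ~` D) = 0%E.
Proof.
have mDC := measurableC measurable_msupport.
have := X_dist m mDC; rewrite /distribution /pushforward => ->.
rewrite /induced_measure integral0_eq // => x Dx.
rewrite kernel_diagE (@kdiag_out _ _ _ (msupport mu)) ?mulr0 //.
Qed.

Let indep n (B : nat -> set E) : (n <= M)%N -> (forall i, measurable (B i)) ->
  P (\bigcap_(i < n) Y i @^-1` B i) = (\prod_(i < n) P (Y i @^-1` B i))%E.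
Proof.
move=> nM mB.
have := @X_indep [set i : 'I_M | (i < n)%N]%SET _ (fun i : 'I_M => mB i).
have YE (i : 'I_M) : Y i = X i by rewrite /Y valKd.
have -> : \bigcap_(i in [set` [set i : 'I_M | (i < n)%N]%SET]) X i @^-1` B i =
    \bigcap_(i < n) Y i @^-1` B i.
  apply/seteqP; split=> [w h i /= iN|w h i /=]; last first.
    by rewrite inE => iN; rewrite -YE; exact: h.
  have iM := leq_trans iN nM.
  by have /= := h (Ordinal iM); rewrite inE -YE; apply.
move=> ->; rewrite (big_ord_widen M (fun i => P (Y i @^-1` B i))) //.
by apply: eq_big => [i|i _]; rewrite ?inE // YE.
Qed.

Let law m (C : set E) : (m < M)%N -> measurable C ->
  P (Y m @^-1` C) = distribution P (X i0) C.
Proof. by move=> mM mC; rewrite X_dist // -(X_dist (insubd i0 m)). Qed.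

Let nuE A : measurable A -> (distribution P (X i0) A =
  \int[mu]_(x in A) (N%:R^-1 * kdiag v x)%:E)%E.
Proof.
move=> mA; rewrite X_dist //; apply: eq_integral => x _.
by rewrite kernel_diagE.
Qed.

(** The bad event is defined from the basis at the sample points, so one exceptional set serves all
    [f], [b] and [x]. *)
Lemma exists_bad_event : exists B : set Omega, [/\ measurable B,
  (P B <= (18 * (N%:R ^+ 2)^-1)%:E)%E &
  forall w, ~ B w -> forall f b, V f -> (forall m, normc (f (X m w)) <= b) ->
    forall x, normc (f x) ^+ 2 <= 8 * M%:R * b ^+ 2 * kernel_diag v x].
Proof.
have hM : 16 * N%:R * ln N%:R <= M%:R :> R.
  apply: le_trans (sample_size_ge (ltnW N1)).
  by rewrite ler_wpM2r ?ln_ge0 ?ler1n 1?ltnW // ler_wpM2r // ler_nat.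
exists (bad_event v Y M).
have [mB PB] := bad_event_measurable_bound (ltnW N1) measurable_msupport mv
  v_lty v_ortho v0 kernel_diag_ge1 nuE indep law hM.
split=> // w /not_bad_event[frob1 sumK] f b Vf fb x.
have [_ _ /(_ _ Vf)[c fE]] := v_basis.
rewrite normc_sq kernel_diagE fE.
apply: (norming_bound frob1 sumK) => i iM.
have := fb (insubd i0 i); rewrite fE -normc_sq => h.
rewrite lerXn2r ?nnegrE ?(le_trans _ h) //.
by case: (\sum_ _ _) => ? ?; exact: sqrtr_ge0.
by case: (\sum_ _ _) => ? ?; exact: sqrtr_ge0.
Qed.

End one_level.

(** * Almost sure passage to all levels *)

Lemma ae_forall_ord d (T : measurableType d) (R : realType)
    (P : probability T R) (M : nat) (A : 'I_M -> T -> Prop) :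
  (forall m, {ae P, forall x, A m x}) -> {ae P, forall x, forall m, A m x}.
Proof.
move=> aeA.
have aeA' k : {ae P, forall x, forall kM : (k < M)%N, A (Ordinal kM) x}.
  have [kM|kM] := pselect (k < M)%N; last exact: aeW.
  apply: filterS (aeA (Ordinal kM)) => x Ax kM'.
  by rewrite (bool_irrelevance kM' kM).
by apply: filterS (ae_foralln aeA') => x Ax [k kM]; exact: Ax.
Qed.

Lemma le_powR_ln_ratio (R : realType) (N : nat) (K q : R) : (1 < N)%N ->
  ln K / ln N%:R < q -> K <= N%:R `^ q.
Proof.
move=> N1 h; have lnN : 0 < ln N%:R :> R by rewrite ln_gt0 // ltr1n.
have N0 : 0 < N%:R :> R by rewrite ltr0n ltnW.
have [K0|K0] := leP K 0; first by apply: le_trans K0 _; exact: powR_ge0.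
rewrite -ler_ln ?posrE ?powR_gt0 // ln_powR.
by move: h; rewrite ltr_pdivrMr // => /ltW.
Qed.

Theorem theorem4p7 (R : realType) (d : nat)
  (mu : probability (borel_space R d) R)
  (V : nat -> set (borel_space R d -> R[i]))
  (N : nat -> nat)
  (v : forall n, 'I_(N n) -> borel_space R d -> R[i])
  (hV : hierarchical mu V v)
  (hK : forall n, (kernel_sup mu (v n) < +oo)%E)
  (hq : (qstar mu v < +oo)%E)
  (h1 : V 0%N (\1_(msupport mu)))
  (d' : measure_display) (Omega : measurableType d') (P : probability Omega R)
  (X : forall n, 'I_(sample_size R (N n)) -> {RV P >-> borel_space R d})
  (hXindep : forall n, mutually_independent P (fun m => X n m : Omega -> _))
  (hXdist : forall n m A, measurable A ->
    distribution P (X n m) A = induced_measure mu (v n) A) :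
  {ae P, forall omega, forall tau : R, 0 < tau ->
    asymptotic_WAM mu V N
      (fun n => [fset X n m omega | m in 'I_(sample_size R (N n))]%fset)
      (1 + tau) ((fine (qstar mu v) + 1) / 2 + tau)}.
Proof.
have [V_sub v_basis V_mono N_lt N_ge1] := hV.
have N_gt n : (n < N n)%N.
  elim: n => [|n IHn]; first exact: N_ge1.
  exact: leq_ltn_trans IHn (N_lt n).
have V1 n : V n (\1_(msupport mu)) by elim: n => [|n IHn] //; exact: V_mono.
(* At level 0 the dimension may be 1 and the sample empty, so [B n] is attached to level [n.+1]. *)
have N_gt1 n : (1 < N n.+1)%N by exact: leq_ltn_trans (N_gt n.+1).
have [B HB] := choice (fun n => exists_bad_event (V_sub n.+1) (v_basis n.+1)
  (V1 n.+1) (N_gt1 n) (hXindep n.+1) (hXdist n.+1)).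
have mB n : measurable (B n) by have [] := HB n.
have limsup0 : P (lim_sup_set B) = 0%E.
  apply: lim_sup_set_cvg0 => //; apply: (@inv_sq_summable _ _ 18) => // n.
  have [_ + _] := HB n; move=> /le_trans; apply.
  rewrite lee_fin ler_wpM2l // lef_pV2 ?posrE ?exprn_gt0 ?ltr0n //.
  by rewrite lerXn2r ?nnegrE // ler_nat ltnW // ltnW // N_gt.
have aeB : {ae P, forall w, ~ lim_sup_set B w}.
  exists (lim_sup_set B); split => //; last by move=> w /= /contrapT.
  by apply: bigcapT_measurable => n; apply: bigcup_measurable.
have aeX : {ae P, forall w n m, msupport mu (X n m w)}.
  apply: ae_foralln => n; apply: ae_forall_ord => m.
  exists (X n m @^-1` ~` msupport mu); split => //.
    rewrite -[X in measurable X]setTI; apply: measurable_funP => //.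
    by apply: measurableC; exact: measurable_msupport.
  exact: (sample_in_support (V_sub n) (v_basis n) (hXdist n)).
(* Neither exceptional set involves [tau], so one event of probability 1 serves all [tau > 0]. *)
apply: filterS2 aeB aeX => w limsupB suppX tau tau0.
split; first by move=> n x /imfsetP[m _ ->]; exact: suppX.
have [n1 n1B] : exists n1, forall n, (n1 <= n)%N -> ~ B n w.
  have /existsNP[n1 /not_implyP[_ h]] := limsupB.
  by exists n1 => n n1n Bn; apply: h; exists n.
have [n2 n2q] : exists n2, forall n, (n2 <= n)%N ->
    ln (fine (kernel_sup mu (v n))) / ln (N n)%:R < fine (qstar mu v) + tau.
  have : (qstar mu v < (fine (qstar mu v) + tau)%:E)%E.
    (* If [qstar] is -oo, its [fine] value is 0 and the strict inequality still holds. *)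
    move: hq; case: (qstar mu v) => [q| |] //= _; last exact: ltNyr.
    by rewrite lte_fin ltrDl.
  by move=> /limn_esup_lt_eventually[n2 h]; exists n2 => n /h; rewrite lte_fin.
pose ka := 25 / tau + 1.
have ka0 : 0 <= ka by rewrite addr_ge0 // divr_ge0 // ltW.
(* The successor of [n1] undoes the shift of levels. The constant [8 * ka] combines |f|^2 <= 8 M b^2
   K with M <= ka N^(1 + tau). *)
exists (maxn n1.+1 n2), ka, (Num.sqrt (8 * ka)) => -[|n].
  by rewrite geq_max.
rewrite geq_max ltnS => /andP[n1n n2n]; split; last first.
  apply: le_trans _ (@sample_size_powR R tau _ tau0 (N_ge1 n.+1)).
  rewrite ler_nat; apply: leq_trans (leq_imfset_card _ _ _) _.
  by rewrite -cardE card_ord.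
move=> f Vf; apply: ge_ereal_sup => _ [x Dx <-]; rewrite lee_fin.
set b := \big[Order.max/0]_(_ <- _) _.
have fb m : normc (f (X n.+1 m w)) <= b.
  apply: (@Order.TotalTheory.bigmax_sup_seq _ R _ _ _ (X n.+1 m w)) => //.
  exact: in_imfset.
have b0 : 0 <= b by exact: bigmax_ge_id.
have [_ _ /(_ w (n1B n n1n) f b Vf fb x) fx] := HB n.
have Kx : kernel_diag (v n.+1) x <= (N n.+1)%:R `^ (fine (qstar mu v) + tau).
  apply: le_trans (le_powR_ln_ratio (N_gt1 n) (n2q _ n2n)).
  have K_fin : kernel_sup mu (v n.+1) \is a fin_num.
    rewrite fin_numElt hK andbT.
    apply: (@lt_le_trans _ _ (kernel_diag (v n.+1) x)%:E); first exact: ltNyr.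
    by apply: ereal_sup_ubound; exists x.
  rewrite -lee_fin fineK //.
  by apply: ereal_sup_ubound; exists x.
have Npos : 0 < (N n.+1)%:R :> R by rewrite ltr0n N_ge1.
set s := Num.sqrt _; set t := _ `^ _.
have st : 0 <= s * t by rewrite mulr_ge0 ?sqrtr_ge0 ?powR_ge0.
have fx_ge0 : 0 <= normc (f x).
  by case: (f x) => p q; exact: sqrtr_ge0.
rewrite -(@ler_pXn2r _ 2) ?nnegrE ?(mulr_ge0 st b0) //.
apply: le_trans fx _.
rewrite 2!exprMn sqr_sqrtr ?mulr_ge0 //.
(* Twice the exponent is (1 + tau) + (q + tau), with q = [fine (qstar mu v)]: one [tau] pays for the
   logarithm in M, the other for the limit superior. *)
have -> : t ^+ 2 = (N n.+1)%:R `^ (1 + tau) *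
    (N n.+1)%:R `^ (fine (qstar mu v) + tau).
  rewrite -powR_mulrn ?powR_ge0 // -powRrM -powRD ?(gt_eqF Npos) ?implybT //.
  by congr (_ `^ _); field.
have -> : 8 * ka * ((N n.+1)%:R `^ (1 + tau) *
    (N n.+1)%:R `^ (fine (qstar mu v) + tau)) * b ^+ 2 =
    8 * (ka * (N n.+1)%:R `^ (1 + tau)) * b ^+ 2 *
    (N n.+1)%:R `^ (fine (qstar mu v) + tau) by ring.
apply: ler_pM => //.
- by rewrite !mulr_ge0 ?sqr_ge0.
- by rewrite sumr_ge0 // => i _; rewrite sqr_ge0.
rewrite ler_wpM2r ?sqr_ge0 // ler_wpM2l //.
exact: sample_size_powR.
Qed.
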